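(* Let $0<q<\lfloor n/2\rfloor$ (where $q$ may depend on $n$) with fractional part $\widehat q := q-\lfloor q\rfloor\neq 0$. Let $\eta\sim\mathcal{N}(0,\sigma^2)$ be a Gaussian random variable, where $\sigma=\sigma(n)\in(0,1)$ satisfies $\sigma(n)=o(1)$ as $n\to\infty$. Then $$ \mathbb{E}_{\eta}\left[\mathrm{SOS}_{\mathrm{rk}}\bigl(\mathrm{MK}(q+\eta)\bigr)\right] = O\left(\sqrt{n}\left(\sqrt{q}\,\log n+\log(1/\sigma)\right)\right) $$ as $n\to\infty$, where $\mathrm{SOS}_{\mathrm{rk}}(\mathrm{MK}(q'))$ denotes the SOS rank of the unweighted minimum knapsack instance $\mathrm{MK}(q')$ on $n$ variables, and the implied constant does not depend on $q$.
   Context: For $\mathbf{x}\in\{0,1\}^n$ write $|\mathbf{x}|=\sum_{i=1}^n x_i$. For $q\in\mathbb{R}$, the instance $\mathrm{MK}(q)$ is the problem of minimizing $|\mathbf{x}|$ subject to $|\mathbf{x}|\ge q$, $\mathbf{x}\in\{0,1\}^n$; for $0\le q\le n$ its optimal value is $\lceil q\rceil$. A polynomial in $\mathbb{R}[x_1,\dots,x_n]$ is SOS if it is a finite sum of squares of real polynomials. For $0\le q\le n$, a degree-$d$ SOS certificate of optimality for $\mathrm{MK}(q)$ consists of SOS polynomials $s_0,s_1\in\mathbb{R}[x_1,\dots,x_n]$ with $\deg(s_0)\le 2d+2$, $\deg(s_1)\le 2d$ and $$|\mathbf{x}|-\lceil q\rceil = s_0(\mathbf{x})+s_1(\mathbf{x})(|\mathbf{x}|-q)\quad\text{for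 all }\mathbf{x}\in\{0,1\}^n.$$ The SOS rank $\mathrm{SOS}_{\mathrm{rk}}(\mathrm{MK}(q))$ is the smallest $d\in\mathbb{Z}_{\ge 0}$ for which such a certificate exists. For $q\notin[0,n]$ (where the optimal value is $0$ if $q<0$, and the problem is infeasible if $q>n$) the SOS rank is $0$. *)

(* Defs.v *)
From HB Require Import structures.
From mathcomp Require Import all_boot all_order all_algebra.
From mathcomp Require Import all_classical all_reals all_analysis.
(* The notations of mpoly clash with those of mathcomp-analysis. *)
From mathcomp Require Import -(notations) mpoly.

Set Implicit Arguments.
Unset Strict Implicit.
Unset Printing Implicit Defensive.

Import Order.TTheory GRing.Theory Num.Theory.
Import numFieldNormedType.Exports.

Local Open Scope classical_set_scope.
Local Open Scope ring_scope.

Section SOSRank.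
Context {R : realType} (n : nat).

(* {mpoly R[n]} *)
Definition mpolynomial := mpoly n R.

(* [mmeasure mdeg p] is [msize p], i.e. 1 + deg p, and 0 for p = 0. *)
Definition degree_le (k : nat) (p : mpolynomial) : Prop :=
  (mmeasure mdeg p <= k.+1)%N.

Definition is_SOS (p : mpolynomial) : Prop :=
  exists s : seq mpolynomial, p = \sum_(f <- s) f ^+ 2.

Definition eval_cube (p : mpolynomial) (x : {ffun 'I_n -> bool}) : R :=
  meval (fun i => (x i)%:R) p.

Definition weight (x : {ffun 'I_n -> bool}) : nat := (\sum_(i < n) x i)%N.

Definition MK_certificate (q : R) (d : nat) : Prop :=
  exists s0 s1 : mpolynomial,
    [/\ is_SOS s0, is_SOS s1,
        degree_le (2 * d + 2) s0, degree_le (2 * d) s1 &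
        forall x : {ffun 'I_n -> bool},
          (weight x)%:R - (Num.ceil q)%:~R
          = eval_cube s0 x + eval_cube s1 x * ((weight x)%:R - q)].

(* The least d admitting a certificate; +oo, rather than a junk finite value,
   if there were none. *)
Definition SOS_rank (q : R) : \bar R :=
  if 0 <= q <= n%:R then ereal_inf [set d%:R%:E | d in MK_certificate q]
  else 0%E.

End SOSRank.

Arguments SOS_rank {R} n q.

(* Main.v *)
Require Import Defs.
From HB Require Import structures.
From mathcomp Require Import all_boot all_order all_algebra.
From mathcomp Require Import all_classical all_reals all_analysis.
From mathcomp Require Import measurable_realfun ring lra zify.
From mathcomp Require Import -(notations) mpoly.

Set Implicit Arguments.
Unset Strict Implicit.
Unset Printing Implicit Defensive.

Import Order.TTheory GRing.Theory Num.Theory.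
Import numFieldNormedType.Exports.

Local Open Scope classical_set_scope.
Local Open Scope ring_scope.

(** Both the multiplier s1 and the remainder s0 are symmetric, i.e. polynomials
    in t = |x|.  With m = ceil q, the multiplier must take the value
    (m - k) / (q - k) at each k < m; it is the corresponding combination of
    binom(t, k) F_k(t)^2, where F_k vanishes at k+1, ..., m, equals 1 at k, and
    contains powers of Dirichlet kernels that damp it on [m+1, n+2].  Thus
    s1 <= 1/2 there, and t - m - s1 (t - q) is the product of t (t-1) ... (t-m)
    and a polynomial that is nonnegative on [m+1, n+2], hence a combination of
    squares with weights t - (m+1) and n+2 - t.  Falling factorials of |x| and
    n+2 - |x| are sums of squares on the cube.  A kernel of degree sqrt(n/i) for
    each i <= m suffices to control the products, which costs degree
    sqrt(n m) log m, and 2^-r is gained from r more kernels of degree sqrt n,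
    where 2^-r is at most the fractional part of q.

    On average over the noise, r is log(1/sigma) + O(1) because the fractional
    part of q + eta is below 2^-k with probability O(2^-k / sigma). *)

(** * Dirichlet kernels *)

(** With [s = 1 - cos a], [T] is [cos (l a)] and [W] is the Dirichlet kernel
    [1 + 2 cos a + ... + 2 cos (l a)]. The recursion [T1 = T - s W], [W1 = W + 2 T1] preserves the
    quadratic form in [T] and [W], which keeps the argument algebraic. *)
Lemma dirichlet_kernel (R : realFieldType) (l : nat) :
  exists T W : {poly R},
    [/\ (size T <= l.+1)%N, (size W <= l.+1)%N, T.[0] = 1,
        W.[0] = (2 * l + 1)%N%:R &
        forall s, 0 <= s <= 1 ->
          [/\ T.[s] ^+ 2 - s * T.[s] * W.[s] + s / 2 * W.[s] ^+ 2 = 1 - s / 2,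
              s * W.[s] ^+ 2 <= 2 & `|W.[s]| <= (2 * l + 1)%N%:R]].
Proof.
(* Completing the square in [T] bounds [s W^2]; completing it in [W] bounds [T], and then [W] grows
   by at most 2 per step. *)
have bounds (s T W : R) : 0 <= s <= 1 ->
    T ^+ 2 - s * T * W + s / 2 * W ^+ 2 = 1 - s / 2 ->
    s * W ^+ 2 <= 2 /\ `|T| <= 1.
  move=> /andP[s0 s1] h; split.
    have h1 : (1 - s / 2) * (s / 2 * W ^+ 2) <= (1 - s / 2) * 1.
      rewrite mulr1 -[leRHS]h.
      have -> : T ^+ 2 - s * T * W + s / 2 * W ^+ 2 =
        (1 - s / 2) * (s / 2 * W ^+ 2) + (T - s / 2 * W) ^+ 2 by field.
      by rewrite lerDl sqr_ge0.
    by rewrite ler_pM2l in h1; lra.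
  have h1 : (1 - s / 2) * T ^+ 2 <= (1 - s / 2) * 1.
    rewrite mulr1 -[leRHS]h.
    have -> : T ^+ 2 - s * T * W + s / 2 * W ^+ 2 =
      (1 - s / 2) * T ^+ 2 + s / 2 * (W - T) ^+ 2 by field.
    by rewrite lerDl mulr_ge0 ?sqr_ge0//; lra.
  rewrite ler_pM2l in h1; last by lra.
  by rewrite -(@ler_pXn2r _ 2) ?nnegrE// real_normK ?num_real// expr1n.
elim: l => [|l [T [W [sT sW T0 W0 TW]]]].
  exists 1, 1; rewrite size_poly1; split=> [//|//|||s s01].
  - by rewrite hornerE.
  - by rewrite hornerE.
  have h : (1 : R) ^+ 2 - s * 1 * 1 + s / 2 * 1 ^+ 2 = 1 - s / 2 by field.
  have [h1 _] := bounds _ _ _ s01 h.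
  have -> : (1 : {poly R}).[s] = 1 by rewrite hornerE.
  by rewrite normr1.
pose T1 := T - 'X * W; pose W1 := W + 2%:R *: T1.
have sT1 : (size T1 <= l.+2)%N.
  rewrite (leq_trans (size_polyD _ _))// geq_max (leq_trans sT)//=.
  rewrite size_polyN (leq_trans (size_polyMleq _ _))// size_polyX/=.
  exact: sW.
have T1E s : T1.[s] = T.[s] - s * W.[s] by rewrite !hornerE.
have W1E s : W1.[s] = W.[s] + 2 * T1.[s] by rewrite hornerD hornerZ.
exists T1, W1; split => //.
- rewrite (leq_trans (size_polyD _ _))// geq_max (leq_trans sW)//=.
  exact: leq_trans (size_scale_leq _ _) sT1.
- by rewrite T1E T0 mul0r subr0.
- rewrite W1E T1E T0 W0 mul0r subr0 mulr1 -[2]/(2%:R) -natrD.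
  by congr (_%:R); lia.
move=> s s01; have [h1 h2 h3] := TW s s01.
have h : T1.[s] ^+ 2 - s * T1.[s] * W1.[s] + s / 2 * W1.[s] ^+ 2 = 1 - s / 2.
  rewrite -h1 W1E T1E; set a := T.[s]; set b := W.[s]; by field.
have [h4 h5] := bounds _ _ _ s01 h.
split=> //; rewrite W1E (le_trans (ler_normD _ _))// normrM gtr0_norm//.
have -> : (2 * l.+1 + 1)%N%:R = (2 * l + 1)%N%:R + 2 * 1 :> R.
  by rewrite mulr1 -[2]/(2%:R) -natrD; congr (_%:R); lia.
by rewrite lerD// ler_pM2l.
Qed.

(** The Dirichlet kernel is rescaled to [0, N] and divided by its value at 0. The decay of [w^2], of
    order [N / (u l^2)], is [s W^2 <= 2] at [s = u / N]. *)
Lemma damping_kernel (R : realFieldType) (N : R) (l : nat) : 0 < N ->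
  exists w : {poly R},
    [/\ (size w <= l.+1)%N, w.[0] = 1 &
        forall u, 0 <= u <= N ->
          w.[u] ^+ 2 <= 1 /\ u * w.[u] ^+ 2 * (2 * l + 1)%N%:R ^+ 2 <= 2 * N].
Proof.
move=> N0; have [T [W [_ sW _ W0 TW]]] := dirichlet_kernel R l.
set c : R := (2 * l + 1)%N%:R.
have c0 : 0 < c by rewrite ltr0n addn1.
pose w := c^-1 *: (W \Po (N^-1 *: 'X)).
have wE u : w.[u] = W.[u / N] / c.
  by rewrite hornerZ horner_comp hornerZ hornerX mulrC [u / N]mulrC.
exists w; split.
- rewrite (leq_trans (size_scale_leq _ _))//.
  rewrite (leq_trans (size_comp_poly_leq _ _))// ltnS.
  have : (size (N^-1 *: 'X : {poly R})).-1 = 1%N.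
    by rewrite size_scale ?size_polyX// invr_neq0// gt_eqF.
  by move=> ->; rewrite muln1; case: (size W) sW.
- by rewrite wE mul0r W0 divff// gt_eqF.
move=> u /andP[u0 uN].
have s01 : 0 <= u / N <= 1.
  by apply/andP; split; [rewrite divr_ge0 // ltW|rewrite ler_pdivrMr// mul1r].
have [_ h1 h2] := TW _ s01; rewrite wE; split.
  rewrite -real_normK ?num_real// exprn_ile1// normrM normfV.
  by rewrite (gtr0_norm c0) ler_pdivrMr// mul1r.
rewrite exprMn exprVn -mulrA -[X in u * X]mulrA mulVf ?mulr1; last first.
  by rewrite expf_neq0// gt_eqF.
by move: h1; rewrite [u / N * _ ^+ 2]mulrAC ler_pdivrMr.
Qed.

(** * Damped products *)

Lemma prod_ler1 (R : realDomainType) (I : Type) (r : seq I) (P : pred I)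
    (F : I -> R) :
  (forall i, P i -> 0 <= F i <= 1) -> 0 <= \prod_(i <- r | P i) F i <= 1.
Proof.
move=> F01; elim/big_ind: _ => // [|x y /andP[x0 x1] /andP[y0 y1]].
  by rewrite ler01 lexx.
by rewrite mulr_ge0//= mulr_ile1.
Qed.

Lemma ler_prod_widen (R : realDomainType) (j m : nat) (h : nat -> R) :
  (j <= m)%N -> (forall i, (i < m)%N -> 0 <= h i <= 1) ->
  \prod_(i < m) h i <= \prod_(i < j) h i.
Proof.
move=> jm h01; rewrite -!(big_mkord xpredT) (big_cat_nat _ jm)//=.
rewrite -[leRHS]mulr1 !big_nat ler_wpM2l//.
  apply: (@proj1 _ (_ <= 1)); apply/andP/prod_ler1 => i /= ij.
  by apply: h01; apply: leq_trans jm.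
apply: (@proj2 (0 <= _)); apply/andP/prod_ler1 => i /andP[_ im].
exact: h01.
Qed.

Lemma prod_succ_ratio (R : realFieldType) (k : nat) :
  \prod_(i < k) (1 + i.+1%:R^-1) = k.+1%:R :> R.
Proof.
elim: k => [|k IH]; first by rewrite big_ord0.
rewrite big_ord_recr/= IH mulrDr mulr1 divff ?pnatr_eq0//.
by rewrite -[1]/(1%:R) -natrD addn1.
Qed.

Lemma bernoulli_ler (R : realDomainType) (x : R) (n : nat) : 0 <= x ->
  1 + n%:R * x <= (1 + x) ^+ n.
Proof.
move=> x0; elim: n => [|n IH]; first by rewrite mul0r addr0 expr0.
rewrite exprS -natr1; have n0 : 0 <= n%:R :> R by [].
rewrite (@le_trans _ _ ((1 + x) * (1 + n%:R * x)))//.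
  rewrite -subr_ge0; have -> : (1 + x) * (1 + n%:R * x) - (1 + (n%:R + 1) * x)
    = n%:R * x ^+ 2 by ring.
  by rewrite mulr_ge0// sqr_ge0.
by rewrite ler_wpM2l// addr_ge0.
Qed.

Section DampedProducts.
Variables (R : archiRealFieldType) (m : nat) (u : R) (h : nat -> R).
Hypothesis u1 : 1 <= u.
Hypothesis h01 : forall i, (i < m)%N -> 0 <= h i <= 1.
Hypothesis hu : forall i, (i < m)%N -> 4 * u * h i <= i.+1%:R.

Let quarter (x : R) : 4 * u * x <= u -> x <= 4^-1.
Proof.
have u0 : 0 < u by rewrite (lt_le_trans _ u1).
by rewrite mulrAC -[leRHS]mul1r ler_pM2r// => h4; lra.
Qed.

(** Here [h i] stands for the square of the i-th damping kernel at [u], hence is at most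
    [(i+1) / (4u)]. As [i+1 <= j <= u], the factor [1 - u/(i+1)] is at most [u/(i+1)] in absolute
    value, and one [h i] cancels it. *)
Lemma damped_vanishing_product (j : nat) : (j <= m)%N -> j%:R <= u ->
  (\prod_(i < j) (1 - u / i.+1%:R)) ^+ 2 * (\prod_(i < m) h i) ^+ 2 <= 1.
Proof.
move=> jm ju.
rewrite -exprMn -real_normK ?num_real// exprn_ile1// normrM.
have h0 : 0 <= \prod_(i < m) h i.
  by apply: prodr_ge0 => i _; case/andP: (h01 (ltn_ord i)).
rewrite (ger0_norm h0) normr_prod.
apply: (@le_trans _ _ (\prod_(i < j) (`|1 - u / i.+1%:R| * h i))).
  by rewrite big_split/= ler_wpM2l ?prodr_ge0 ?ler_prod_widen.
apply: (@proj2 (0 <= _)); apply/andP/prod_ler1 => i _.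
have im : (i < m)%N by apply: leq_trans jm.
have /andP[hi0 hi1] := h01 im.
rewrite mulr_ge0//=.
have i0 : 0 < i.+1%:R :> R by [].
have iu : i.+1%:R <= u by apply: le_trans ju; rewrite ler_nat.
have iu' : 1 <= u / i.+1%:R by rewrite ler_pdivlMr// mul1r.
rewrite ler0_norm ?subr_le0// opprB.
rewrite (@le_trans _ _ (u / i.+1%:R * h i))// ?ler_wpM2r// ?lerBlDr ?lerDl//.
rewrite mulrAC ler_pdivrMr// mul1r (le_trans _ (hu im))//.
by rewrite -mulrA ler_peMl ?ler1n// mulr_ge0// (le_trans _ u1).
Qed.

(** For [k <= u] each factor is at most [2u/(i+1)] and one power of the kernels suffices. For
    [u < k] only about [u] kernels are known to be small, while the product may reach [(k+1)^(2v)]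
    with [v] the integer part of [u]; this is what costs the power [B], of order log m. *)
Lemma damped_binomial_product (k B : nat) : (k < m)%N -> (m <= 2 ^ B)%N ->
  (0 < B)%N -> (\prod_(i < k) (1 + u / i.+1%:R)) * (\prod_(i < m) h i) ^+ B <= 1.
Proof.
move=> km mB B0.
have h0 : 0 <= \prod_(i < m) h i.
  by apply: prodr_ge0 => i _; case/andP: (h01 (ltn_ord i)).
have h1 : \prod_(i < m) h i <= 1.
  by case/andP: (prod_ler1 (index_enum _) (P:=xpredT) (fun i _ => h01 (ltn_ord i))).
have u0 : 0 <= u by rewrite (le_trans _ u1).
have q0 (j : nat) : 0 <= 1 + u / j.+1%:R by rewrite addr_ge0// divr_ge0.
have [ku|uk] := leP k%:R u.
  apply: (@le_trans _ _ (\prod_(i < k) ((1 + u / i.+1%:R) * h i))).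
    rewrite big_split/= ler_wpM2l ?prodr_ge0//.
    rewrite (@le_trans _ _ (\prod_(i < m) h i)) ?ler_prod_widen// ?(ltnW km)//.
    by rewrite -(prednK B0) exprS ler_piMr// exprn_ile1.
  apply: (@proj2 (0 <= _)); apply/andP/prod_ler1 => i _.
  have im : (i < m)%N by apply: ltn_trans km.
  have /andP[hi0 hi1] := h01 im.
  rewrite mulr_ge0//=.
  have i0 : 0 < i.+1%:R :> R by [].
  have iu : i.+1%:R <= u by apply: le_trans ku; rewrite ler_nat.
  have iu' : 1 <= u / i.+1%:R by rewrite ler_pdivlMr// mul1r.
  rewrite (@le_trans _ _ (2 * (u / i.+1%:R) * h i))// ?ler_wpM2r//.
    by rewrite mulr_natl mulr2n lerD2r.
  rewrite mulrA [2 * u / _ * _]mulrAC ler_pdivrMr// mul1r.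
  by rewrite (le_trans _ (hu im))// !ler_wpM2r// ler_nat.
have /andP[vu uv] := truncn_itv u0.
set v := Num.truncn u in vu uv.
have v1 : (0 < v)%N by rewrite truncn_gt0.
have vk : (v < k)%N by rewrite -(ltr_nat R) (le_lt_trans vu).
(* Since [u < v+1 <= 2v], Bernoulli's inequality bounds each factor by [(1 + 1/(i+1))^(2v)], and the
   product of the bases telescopes to [k+1 <= 2^B]. *)
have H1 : \prod_(i < k) (1 + u / i.+1%:R) <= 2 ^+ (B * (2 * v)).
  rewrite exprM; apply: (@le_trans _ _ (k.+1%:R ^+ (2 * v))); last first.
    rewrite lerXn2r ?nnegrE ?exprn_ge0// -natrX ler_nat; exact: leq_trans mB.
  rewrite -prod_succ_ratio -prodrXl; apply: ler_prod => i _; rewrite q0/=.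
  apply: le_trans (bernoulli_ler _ _); last by rewrite invr_ge0.
  rewrite lerD2l ler_wpM2r ?invr_ge0// (le_trans (ltW uv))// ler_nat; lia.
have H2 : \prod_(i < m) h i <= 4^-1 ^+ v.
  apply: (@le_trans _ _ (\prod_(i < v) h i)).
    by apply: ler_prod_widen => //; apply: ltnW; apply: ltn_trans km.
  rewrite -[v in leRHS]card_ord -prodr_const; apply: ler_prod => i _.
  have im : (i < m)%N by apply: ltn_trans km; apply: ltn_trans vk.
  have /andP[-> hi1]/= := h01 im.
  have iu : i.+1%:R <= u by apply: le_trans vu; rewrite ler_nat.
  by apply: quarter; apply: le_trans (hu im) iu.
apply: (@le_trans _ _ (2 ^+ (B * (2 * v)) * (4^-1 ^+ v) ^+ B)).
  apply: ler_pM => //; [|exact: exprn_ge0|].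
    by apply: prodr_ge0 => i _; exact: q0.
  by rewrite lerXn2r ?nnegrE// exprn_ge0// invr_ge0.
rewrite -exprM mulnCA exprM (mulnC v) -exprMn.
have -> : (2 ^+ 2 * 4^-1 : R) = 1 by field.
by rewrite expr1n.
Qed.

(** Of the [2 + B + B] powers, two absorb the vanishing factors and [B] the binomial one. The
    remaining [B] powers and the [r] extra copies of [h 0] each gain a factor 1/4. *)
Lemma damped_selector_product (j k B r : nat) :
  (j <= m)%N -> j%:R <= u -> (k < m)%N -> (m <= 2 ^ B)%N -> (0 < B)%N ->
  \prod_(i < k) (1 + u / i.+1%:R) *
    ((\prod_(i < j) (1 - u / i.+1%:R)) ^+ 2
       * (\prod_(i < m) h i) ^+ (2 + B + B) * h 0%N ^+ r)
  <= 4^-1 ^+ (B + r).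
Proof.
move=> jm ju km mB B0.
have A := damped_vanishing_product jm ju.
have D := damped_binomial_product km mB B0.
have h0 : 0 <= \prod_(i < m) h i.
  by apply: prodr_ge0 => i _; case/andP: (h01 (ltn_ord i)).
have m0 : (0 < m)%N by apply: leq_ltn_trans km.
have /andP[h00 h00'] := h01 m0.
have h04 : h 0%N <= 4^-1 by apply: quarter; apply: le_trans (hu m0) u1.
have hm4 : \prod_(i < m) h i <= 4^-1.
  by apply: le_trans (ler_prod_widen m0 h01) _; rewrite big_ord_recl big_ord0 mulr1.
have u0 : 0 <= u by rewrite (le_trans _ u1).
have q0 : 0 <= \prod_(i < k) (1 + u / i.+1%:R).
  by apply: prodr_ge0 => i _; rewrite addr_ge0// divr_ge0.
rewrite !exprD; move: A D.
set a := (\prod_(i < j) _) ^+ 2; set p := \prod_(i < m) _.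
set b := \prod_(i < k) _ => A D.
rewrite (_ : b * _ = (a * p ^+ 2) * (b * p ^+ B) * (p ^+ B * h 0%N ^+ r));
  last by ring.
have a0 : 0 <= a by exact: sqr_ge0.
have ap0 : 0 <= a * p ^+ 2 by rewrite mulr_ge0// sqr_ge0.
have bp0 : 0 <= b * p ^+ B by rewrite mulr_ge0// exprn_ge0.
rewrite -[leRHS]mul1r; apply: ler_pM.
- exact: mulr_ge0.
- by rewrite mulr_ge0// exprn_ge0.
- exact: mulr_ile1.
- by apply: ler_pM; rewrite ?exprn_ge0// lerXn2r ?nnegrE// invr_ge0.
Qed.

End DampedProducts.

Lemma size_prod_leq_sum (R : idomainType) (I : Type) (r : seq I)
    (F : I -> {poly R}) (d : I -> nat) :
  (forall i, (size (F i) <= (d i).+1)%N) ->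
  (size (\prod_(i <- r) F i)%R <= (\sum_(i <- r) d i).+1)%N.
Proof.
move=> Fd; elim: r => [|i r IH]; first by rewrite !big_nil size_poly1.
rewrite !big_cons (leq_trans (size_polyMleq _ _))//.
by have := Fd i; move: IH; lia.
Qed.

Lemma size_mul_leqS (R : nzRingType) (p q : {poly R}) (a b : nat) :
  (size p <= a.+1)%N -> (size q <= b.+1)%N -> (size (p * q)%R <= (a + b).+1)%N.
Proof. by move=> pa qb; have := size_polyMleq p q; lia. Qed.

Lemma size_exp_leqS (R : nzRingType) (p : {poly R}) (a n : nat) :
  (size p <= a.+1)%N -> (size (p ^+ n)%R <= (n * a).+1)%N.
Proof.
move=> pa; elim: n => [|n IH]; first by rewrite expr0 size_poly1.
by rewrite exprS mulSn; exact: size_mul_leqS.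
Qed.

(** * Selector polynomials *)

Section Selector.
Variables (R : archiRealFieldType) (N : R) (l : nat -> nat) (m : nat).
Hypothesis N0 : 0 < N.
Hypothesis lN : forall i, 8 * N <= i.+1%:R * (2 * l i + 1)%N%:R ^+ 2.

(* The linear factors make F vanish at k+1, ..., m; the powers of the damping
   kernels compensate the growth of these factors and of the binomial
   coefficient beyond m. *)
Lemma damped_selector (k B r : nat) :
  (k < m)%N -> (m <= 2 ^ B)%N -> (0 < B)%N ->
  exists F : {poly R},
    [/\ (size F <= (m - k + (2 + B + B) * (\sum_(i < m) l i) + r * l 0).+1)%N,
        F.[k%:R] = 1,
        forall j, (k < j <= m)%N -> F.[j%:R] = 0 &
        forall t, m.+1%:R <= t <= N ->
          \prod_(i < k) ((t - i%:R) / i.+1%:R) * F.[t] ^+ 2 <= 4^-1 ^+ (B + r)].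
Proof.
move=> km mB B0.
have [w wP] := choice (fun i => damping_kernel (l i) N0).
pose y : {poly R} := 'X - k%:R%:P.
have yE t : y.[t] = t - k%:R by rewrite !hornerE.
have sy : (size y <= 2)%N by rewrite size_XsubC.
have scomp i : (size (w i \Po y) <= (l i).+1)%N.
  rewrite (leq_trans (size_comp_poly_leq _ _))// ltnS size_XsubC muln1.
  by have [+ _ _] := wP i; case: (size (w i)).
pose F := (\prod_(i < m - k) (1 - (i.+1%:R^-1)%:P * y))
  * (\prod_(i < m) (w i \Po y)) ^+ (2 + B + B) * (w 0%N \Po y) ^+ r.
have FE t : F.[t] = (\prod_(i < m - k) (1 - (t - k%:R) / i.+1%:R))
  * (\prod_(i < m) (w i).[t - k%:R]) ^+ (2 + B + B) * (w 0%N).[t - k%:R] ^+ r.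
  rewrite 2!hornerM 2!horner_exp 2!horner_prod horner_comp yE.
  under eq_bigr => i _ do rewrite hornerD hornerN hornerM !hornerC yE mulrC.
  by congr (_ * _ ^+ _ * _); apply: eq_bigr => i _; rewrite horner_comp yE.
exists F; split.
- apply: size_mul_leqS; last exact: size_exp_leqS.
  apply: size_mul_leqS; last by apply: size_exp_leqS; exact: size_prod_leq_sum.
  rewrite -[X in (_ <= X.+1)%N]card_ord -[X in (_ <= X.+1)%N]sum1_card.
  apply: (size_prod_leq_sum _ (d := fun=> 1%N)) => i.
  rewrite (leq_trans (size_polyD _ _))// geq_max size_poly1/= size_polyN.
  by rewrite mul_polyC (leq_trans (size_scale_leq _ _)).
- have w0 i : (w i).[0] = 1 by have [] := wP i.
  rewrite FE subrr w0 expr1n mulr1.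
  rewrite [X in X * _]big1 => [|i _]; last by rewrite mul0r subr0.
  by rewrite mul1r big1 ?expr1n.
- move=> j /andP[kj jm]; rewrite FE.
  have jk : (j - k.+1 < m - k)%N by lia.
  rewrite (bigD1 (Ordinal jk))//=.
  have -> : (j%:R - k%:R : R) = (j - k.+1).+1%:R.
    by rewrite -natrB; [congr (_%:R)|]; lia.
  by rewrite divff ?pnatr_eq0// subrr !mul0r.
move=> t /andP[mt tN]; rewrite FE; set u := t - k%:R.
have ku : (m - k).+1%:R <= u.
  by rewrite lerBrDr -natrD (le_trans _ mt)// ler_nat; lia.
have u1 : 1 <= u by rewrite (le_trans _ ku)// ler1n.
have uN : 0 <= u <= N.
  by rewrite (le_trans ler01 u1)/= (le_trans _ tN)// gerBl.
pose h i := (w i).[u] ^+ 2.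
have h01 i : (i < m)%N -> 0 <= h i <= 1.
  by move=> _; rewrite sqr_ge0/=; have [_ _ /(_ _ uN)[]] := wP i.
(* Four times the decay bound [u h (2l+1)^2 <= 2N] is met by [lN], whence the constant 8 there. *)
have hu i : (i < m)%N -> 4 * u * h i <= i.+1%:R.
  move=> _; have [_ _ /(_ _ uN)[_ h2]] := wP i.
  have c0 : 0 < (2 * l i + 1)%N%:R ^+ 2 :> R by rewrite exprn_gt0// ltr0n addn1.
  rewrite -(ler_pM2r c0) (le_trans _ (lN i))//.
  by move: h2; rewrite -/(h i) => h2; lra.
have ju : (m - k)%:R <= u by rewrite (le_trans _ ku)// ler_nat.
have := damped_selector_product u1 h01 hu r (leq_subr k m) ju km mB B0.
congr (_ <= _); congr (_ * _).
  (* Numerators and denominators are separated because only the numerators are reversed: replacing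
     [i] by [k-1-i] turns [t - i] into [i+1+u]. *)
  have fact_eq (G : nat -> R) : \prod_(i < k) (G i / i.+1%:R) =
      \prod_(i < k) G i / \prod_(i < k) i.+1%:R.
    by rewrite -prodfV -big_split.
  rewrite (fact_eq (fun i => t - i%:R)).
  have -> : \prod_(i < k) (1 + u / i.+1%:R) =
      \prod_(i < k) ((i.+1%:R + u) / i.+1%:R).
    by apply: eq_bigr => i _; rewrite [RHS]mulrDl divff.
  rewrite (fact_eq (fun i => i.+1%:R + u)); congr (_ / _).
  rewrite (reindex_inj rev_ord_inj)/=; apply: eq_bigr => i _.
  rewrite /u subnSK// natrB ?(ltnW (ltn_ord i))//; ring.
have -> : \prod_(i < m) h i = (\prod_(i < m) (w i).[u]) ^+ 2 by rewrite -prodrXl.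
by move: (2 + B + B)%N => b; rewrite /h !exprMn -!exprM !muln2 -!addnn !exprD.
Qed.

End Selector.

(** * Nonnegative polynomials on an interval *)

(** Continuity carries the sign across one excluded point; this recovers the sign of a quotient at
    the root that has been divided out. *)
Lemma horner_ge0_closure (R : realType) (p : {poly R}) (a b r : R) :
  a < b -> a <= r <= b ->
  (forall t, a <= t <= b -> t != r -> 0 <= p.[t]) -> 0 <= p.[r].
Proof.
move=> ab /andP[ar rb] p0; rewrite leNgt; apply/negP => pr.
have : \forall t \near r, p.[t] < 0.
  exact: (@cvgr_lt _ _ _ _ (fun t => p.[t]) _ (@continuous_horner R p r)).
move=> /nbhs_ballP[e /= e0 He].
(* A step of length [d] from [r] towards the farther endpoint stays in [a, b] and in the ball where
   [p] is negative. *)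
pose d := Num.min (e / 2) ((b - a) / 2).
have d0 : 0 < d by rewrite lt_min !divr_gt0// subr_gt0.
have de : d < e by rewrite gt_min ltr_pdivrMr// ltr_pMr// ltr1n.
have dab : d <= (b - a) / 2 by rewrite ge_min lexx orbT.
have near_r t : `|r - t| = d -> a <= t <= b -> False.
  move=> rt tab; have := He t; rewrite /ball/= rt => /(_ de).
  rewrite ltNge p0//; apply/eqP => tr.
  by move: rt d0; rewrite tr subrr normr0 => <-; rewrite ltxx.
have [rm|rm] := leP r ((a + b) / 2).
  apply: (near_r (r + d)); last by lra.
  by rewrite opprD addrA subrr add0r normrN gtr0_norm.
apply: (near_r (r - d)); last by lra.
by rewrite opprB addrC subrK gtr0_norm.
Qed.

(** The Markov-Lukács form of a polynomial nonnegative on [a, b]. The degree is bounded term by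
    term, so that no cancellation of leading terms can hide a large square. *)
Inductive interval_sos (R : nzRingType) (a b : R) (D : nat) : {poly R} -> Prop :=
| interval_sos_sq (g : {poly R}) (e1 e2 : bool) :
    (2 * (size g).-1 + e1 + e2 <= D)%N ->
    interval_sos a b D (g ^+ 2 * ('X - a%:P) ^+ e1 * (b%:P - 'X) ^+ e2)
| interval_sosD p q : interval_sos a b D p -> interval_sos a b D q ->
    interval_sos a b D (p + q).

Section IntervalSOS.
Variables (R : realType) (a b : R).
Implicit Types p q : {poly R}.

Lemma interval_sosC D (c : R) : 0 <= c -> interval_sos a b D c%:P.
Proof.
move=> c0; have -> : c%:P = (Num.sqrt c)%:P ^+ 2 *
    ('X - a%:P) ^+ false * (b%:P - 'X) ^+ false.
  by rewrite !expr0 !mulr1 -polyC_exp sqr_sqrtr.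
by constructor; rewrite size_polyC; case: eqP.
Qed.

Lemma size_pred_mul_XsubC (g : {poly R}) (c : R) :
  ((size (g * ('X - c%:P))%R).-1 <= (size g).-1.+1)%N.
Proof.
have [->|g0] := eqVneq g 0; first by rewrite mul0r size_poly0.
by rewrite size_Mmonic ?monicXsubC// size_XsubC addn2/= leqSpred.
Qed.

(** The new factor either becomes the weight of a term or, where that weight is present already,
    moves with it into the square. *)
Lemma interval_sos_mull D p :
  interval_sos a b D p -> interval_sos a b D.+1 (('X - a%:P) * p).
Proof.
elim=> [g e1 e2 h|q r _ q1 _ r1]; last by rewrite mulrDr; exact: interval_sosD.
case: e1 h => h.
  have -> : ('X - a%:P) * (g ^+ 2 * ('X - a%:P) ^+ true * (b%:P - 'X) ^+ e2) =
      (g * ('X - a%:P)) ^+ 2 * ('X - a%:P) ^+ false * (b%:P - 'X) ^+ e2.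
    by rewrite expr1 expr0 mulr1 exprMn; ring.
  apply: interval_sos_sq;
  move: h (size_pred_mul_XsubC g a) => /=.
  by set x := (size _).-1; set y := (size _).-1; lia.
have -> : ('X - a%:P) * (g ^+ 2 * ('X - a%:P) ^+ false * (b%:P - 'X) ^+ e2) =
    g ^+ 2 * ('X - a%:P) ^+ true * (b%:P - 'X) ^+ e2.
  by rewrite expr1 expr0 mulr1; ring.
by apply: interval_sos_sq; move: h => /=; lia.
Qed.

Lemma interval_sos_mulr D p :
  interval_sos a b D p -> interval_sos a b D.+1 ((b%:P - 'X) * p).
Proof.
elim=> [g e1 e2 h|q r _ q1 _ r1]; last by rewrite mulrDr; exact: interval_sosD.
case: e2 h => h.
  have -> : (b%:P - 'X) * (g ^+ 2 * ('X - a%:P) ^+ e1 * (b%:P - 'X) ^+ true) =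
      (g * ('X - b%:P)) ^+ 2 * ('X - a%:P) ^+ e1 * (b%:P - 'X) ^+ false.
    by rewrite expr1 expr0 mulr1 exprMn; ring.
  apply: interval_sos_sq;
  move: h (size_pred_mul_XsubC g b) => /=.
  by set x := (size _).-1; set y := (size _).-1; lia.
have -> : (b%:P - 'X) * (g ^+ 2 * ('X - a%:P) ^+ e1 * (b%:P - 'X) ^+ false) =
    g ^+ 2 * ('X - a%:P) ^+ e1 * (b%:P - 'X) ^+ true.
  by rewrite expr1 expr0 mulr1; ring.
by apply: interval_sos_sq; move: h => /=; lia.
Qed.

Lemma interval_sos_mulsq D p (c : R) :
  interval_sos a b D p -> interval_sos a b D.+2 (('X - c%:P) ^+ 2 * p).
Proof.
elim=> [g e1 e2 h|q r _ q1 _ r1]; last by rewrite mulrDr; exact: interval_sosD.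
have -> : ('X - c%:P) ^+ 2 * (g ^+ 2 * ('X - a%:P) ^+ e1 * (b%:P - 'X) ^+ e2) =
    (g * ('X - c%:P)) ^+ 2 * ('X - a%:P) ^+ e1 * (b%:P - 'X) ^+ e2.
  by rewrite exprMn; ring.
apply: interval_sos_sq;
  move: h (size_pred_mul_XsubC g c) => /=.
  by set x := (size _).-1; set y := (size _).-1; lia.
Qed.

(* Subtract the minimum c of p on [a, b], attained at r: then p - c is
   divisible by X - a or b - X if r is an endpoint, and by (X - r)^2 if not. *)
Lemma nonneg_interval_sos D p : a < b -> (size p <= D.+1)%N ->
  (forall t, a <= t <= b -> 0 <= p.[t]) -> interval_sos a b D p.
Proof.
move=> ab; have [n] := ubnP D; elim: n => // n IH in D p *.
rewrite ltnS => Dn pD p0.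
case: D => [|D] in Dn pD *.
  rewrite (size1_polyC pD); apply: interval_sosC.
  have -> : p`_0 = p.[a] by rewrite [in RHS](size1_polyC pD) hornerC.
  by apply: p0; rewrite lexx ltW.
have [c cab cmin] : exists2 c, c \in `[a, b]%R &
    forall t, t \in `[a, b]%R -> p.[c] <= p.[t].
  apply: (@EVT_min R (fun t => p.[t])); first exact: ltW.
  by apply: continuous_subspaceT => x; exact: continuous_horner.
move: cab; rewrite in_itv/= => /andP[ac cb].
have pc0 : 0 <= p.[c] by rewrite p0// ac cb.
have /factor_theorem[q pq] : root (p - p.[c]%:P) c.
  by rewrite /root !hornerE subrr.
have qp t : a <= t <= b -> 0 <= q.[t] * (t - c).
  move=> tab; have : (p - p.[c]%:P).[t] = q.[t] * (t - c).
    by rewrite pq !hornerE.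
  by rewrite !hornerE => <-; rewrite subr_ge0 cmin// in_itv.
have pE : p = q * ('X - c%:P) + p.[c]%:P by rewrite -pq subrK.
have sq : (size q <= D.+1)%N.
  have [->|q0] := eqVneq q 0; first by rewrite size_poly0.
  have : (size (p - p.[c]%:P)%R <= D.+2)%N.
    rewrite (leq_trans (size_polyD _ _))// geq_max pD size_polyN.
    exact: leq_trans (size_polyC_leq1 _) _.
  by rewrite pq size_Mmonic ?monicXsubC// size_XsubC addn2.
rewrite pE; apply: interval_sosD; last exact: interval_sosC.
have [ca|ca] := eqVneq c a.
  rewrite mulrC ca; apply: interval_sos_mull; apply: IH => //.
  have pos t : a <= t <= b -> t != a -> 0 <= q.[t].
    move=> /andP[at_ tb] ta; have := qp t; rewrite at_ tb ca => /(_ isT).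
    by rewrite pmulr_lge0// subr_gt0 lt_neqAle eq_sym ta.
  move=> t tab; have [->|] := eqVneq t a; last exact: pos.
  by apply: (horner_ge0_closure ab) => //; rewrite lexx ltW.
have [cb'|cb'] := eqVneq c b.
  have -> : q * ('X - c%:P) = (b%:P - 'X) * (- q) by rewrite cb'; ring.
  apply: interval_sos_mulr; apply: IH => //; first by rewrite size_polyN.
  have pos t : a <= t <= b -> t != b -> 0 <= (- q).[t].
    move=> /andP[at_ tb] ta; have := qp t; rewrite at_ tb cb' => /(_ isT).
    by rewrite -mulrNN -hornerN pmulr_lge0// opprB subr_gt0 lt_neqAle ta.
  move=> t tab; have [->|] := eqVneq t b; last exact: pos.
  by apply: (horner_ge0_closure ab) => //; rewrite lexx ltW.
have {}ac : a < c by rewrite lt_neqAle eq_sym ca.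
have {}cb : c < b by rewrite lt_neqAle cb'.
(* At an interior minimum, [q (t - c) >= 0] makes [q] nonpositive to the left of [c] and nonnegative
   to the right. *)
have qc : q.[c] = 0.
  apply/eqP; rewrite eq_le; apply/andP; split.
    rewrite -oppr_ge0 -hornerN; apply: (horner_ge0_closure ac).
      by rewrite lexx ltW.
    move=> t /andP[at_ tc] tc'; have := qp t.
    rewrite at_ (le_trans tc (ltW cb)) => /(_ isT).
    by rewrite -mulrNN -hornerN pmulr_lge0// opprB subr_gt0 lt_neqAle tc'.
  apply: (horner_ge0_closure cb); first by rewrite lexx ltW.
  move=> t /andP[ct tb] tc'; have := qp t.
  rewrite tb (le_trans (ltW ac) ct) => /(_ isT).
  by rewrite pmulr_lge0// subr_gt0 lt_neqAle eq_sym tc'.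
have /factor_theorem[q' qq'] : root q c by rewrite /root qc.
have -> : q * ('X - c%:P) = ('X - c%:P) ^+ 2 * q' by rewrite qq'; ring.
have [->|q'0] := eqVneq q' 0; first by rewrite mulr0 -polyC0; exact: interval_sosC.
move: sq; rewrite qq' size_Mmonic ?monicXsubC// size_XsubC addn2/=.
have : (0 < size q')%N by rewrite size_poly_gt0.
case: D => [|D] in Dn pD *; first by case: (size q').
rewrite ltnS => _ sq'; apply: interval_sos_mulsq; apply: IH => //.
  by apply: leq_trans Dn; rewrite ltnS leqnSn.
have pos t : a <= t <= b -> t != c -> 0 <= q'.[t].
  move=> tab tc; have := qp t tab; rewrite qq' !hornerE -mulrA -expr2.
  by rewrite pmulr_lge0// exprn_even_gt0//= subr_eq0.
move=> t tab; have [->|] := eqVneq t c; last exact: pos.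
by apply: (horner_ge0_closure ab) => //; rewrite !ltW.
Qed.

End IntervalSOS.

(** * Symmetric sums of squares on the cube *)

(** Only the values on the cube are prescribed, so [x_i^2] may stand for [x_i]. *)
Definition cube_sos (R : realType) (n D : nat) (f : nat -> R) : Prop :=
  exists s : mpolynomial (R := R) n,
    [/\ is_SOS s, degree_le D s & forall x, eval_cube s x = f (weight x)].

Section CubeSOS.
Variables (R : realType) (n : nat).
Implicit Types (s : mpolynomial (R := R) n) (f g : nat -> R).

Lemma is_SOSD s1 s2 : is_SOS s1 -> is_SOS s2 -> is_SOS (s1 + s2).
Proof. by move=> [r1 ->] [r2 ->]; exists (r1 ++ r2); rewrite big_cat. Qed.

Lemma is_SOSM s1 s2 : is_SOS s1 -> is_SOS s2 -> is_SOS (s1 * s2).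
Proof.
move=> [r1 ->] [r2 ->]; exists (allpairs *%R r1 r2).
rewrite big_allpairs_dep/= mulr_suml; apply: eq_bigr => p _.
by rewrite mulr_sumr; apply: eq_bigr => q _; rewrite exprMn.
Qed.

Lemma is_SOS_sqr s : is_SOS (s ^+ 2).
Proof. by exists [:: s]; rewrite big_seq1. Qed.

Lemma is_SOS_sum (I : Type) (r : seq I) (F : I -> mpolynomial (R := R) n) :
  (forall i, is_SOS (F i)) -> is_SOS (\sum_(i <- r) F i).
Proof.
move=> hF; elim/big_ind: _ => //; first by exists [::]; rewrite big_nil.
exact: is_SOSD.
Qed.

Lemma degree_leW D E s : (D <= E)%N -> degree_le D s -> degree_le E s.
Proof. by move=> DE h; exact: leq_trans h _. Qed.

Lemma degree_leD D s1 s2 : degree_le D s1 -> degree_le D s2 ->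
  degree_le D (s1 + s2).
Proof.
by move=> h1 h2; apply: leq_trans (mmeasureD_le _ _ _) _; rewrite geq_max h1.
Qed.

Lemma degree_leM D E s1 s2 : degree_le D s1 -> degree_le E s2 ->
  degree_le (D + E) (s1 * s2).
Proof.
rewrite /degree_le => h1 h2; have [->|s10] := eqVneq s1 0.
  by rewrite mul0r mmeasure0.
have [->|s20] := eqVneq s2 0; first by rewrite mulr0 mmeasure0.
by rewrite msizeM// -subn1 leq_subLR add1n -addnS -addSn leq_add.
Qed.

Lemma degree_le_sum D (I : Type) (r : seq I) (F : I -> mpolynomial (R := R) n) :
  (forall i, degree_le D (F i)) -> degree_le D (\sum_(i <- r) F i).
Proof.
move=> hF; elim/big_ind: _ => //; first by rewrite /degree_le mmeasure0.
exact: degree_leD.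
Qed.

Lemma degree_leC (c : R) : degree_le 0 (mpolyC n c).
Proof. by rewrite /degree_le mmeasureC; case: eqP. Qed.

Lemma degree_leX i : degree_le 1 (mpolyX R (mnm1 i) : mpolynomial n).
Proof. by rewrite /degree_le msizeX mdeg1. Qed.

Lemma degree_le_exp D s k : degree_le D s -> degree_le (k * D) (s ^+ k).
Proof.
move=> h; elim: k => [|k IH]; last by rewrite exprS mulSn; exact: degree_leM.
by rewrite expr0 -mpolyC1; exact: degree_leC.
Qed.

Lemma degree_le_prod D (I : Type) (r : seq I) (F : I -> mpolynomial (R := R) n) :
  (forall i, degree_le D (F i)) ->
  degree_le (size r * D) (\prod_(i <- r) F i).
Proof.
move=> hF; elim: r => [|i r IH].
  by rewrite big_nil -mpolyC1; exact: degree_leC.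
by rewrite big_cons mulSn; exact: degree_leM.
Qed.

Lemma cube_sos_eq D f g : (forall t, (t <= n)%N -> f t = g t) ->
  cube_sos n D f -> cube_sos n D g.
Proof.
move=> fg [s [s1 s2 s3]]; exists s; split=> // x; rewrite s3 fg//.
rewrite /weight -[X in (_ <= X)%N]card_ord -sum1_card; apply: leq_sum => i _.
by case: (x i).
Qed.

Lemma cube_sosW D E f : (D <= E)%N -> cube_sos n D f -> cube_sos n E f.
Proof. by move=> DE [s [s1 /(degree_leW DE) s2 s3]]; exists s. Qed.

Lemma cube_sosD D f g : cube_sos n D f -> cube_sos n D g ->
  cube_sos n D (fun t => f t + g t).
Proof.
move=> [s [s1 s2 s3]] [r [r1 r2 r3]]; exists (s + r); split.
- exact: is_SOSD.
- exact: degree_leD.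
- by move=> x; rewrite /eval_cube mevalD -!/(eval_cube _ _) s3 r3.
Qed.

Lemma cube_sosM D E f g : cube_sos n D f -> cube_sos n E g ->
  cube_sos n (D + E) (fun t => f t * g t).
Proof.
move=> [s [s1 s2 s3]] [r [r1 r2 r3]]; exists (s * r); split.
- exact: is_SOSM.
- exact: degree_leM.
- by move=> x; rewrite /eval_cube mevalM -!/(eval_cube _ _) s3 r3.
Qed.

Lemma cube_sosC (c : R) : 0 <= c -> cube_sos n 0 (fun=> c).
Proof.
move=> c0; exists (mpolyC n (Num.sqrt c) ^+ 2); split.
- exact: is_SOS_sqr.
- by have := degree_le_exp 2 (degree_leC (Num.sqrt c)).
- by move=> x; rewrite /eval_cube rmorphXn/= mevalC sqr_sqrtr.
Qed.

Lemma cube_sos_sum D (I : Type) (r : seq I) (F : I -> nat -> R) :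
  (forall i, cube_sos n D (F i)) ->
  cube_sos n D (fun t => \sum_(i <- r) F i t).
Proof.
move=> hF; elim: r => [|i r IH].
  apply: (@cube_sos_eq _ (fun=> 0)); first by move=> t _; rewrite big_nil.
  by apply: (cube_sosW (leq0n D)); exact: cube_sosC.
apply: cube_sos_eq (cube_sosD (hF i) IH) => t _.
by rewrite big_cons.
Qed.

Lemma eval_cubeX (x : {ffun 'I_n -> bool}) i :
  eval_cube (mpolyX R (mnm1 i)) x = (x i)%:R.
Proof. by rewrite /eval_cube mevalXU. Qed.

Lemma cube_sos_sqr (p : {poly R}) :
  cube_sos n (2 * (size p).-1) (fun t => p.[t%:R] ^+ 2).
Proof.
pose w : mpolynomial n := \sum_(j < n) mpolyX R (mnm1 j).
pose s : mpolynomial n := \sum_(i < size p) mpolyC n p`_i * w ^+ i.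
exists (s ^+ 2); split; first exact: is_SOS_sqr.
  apply: degree_le_exp; apply: degree_le_sum => i.
  have wi : degree_le (i * 1) (w ^+ i).
    by apply: degree_le_exp; apply: degree_le_sum => j; exact: degree_leX.
  apply: degree_leW (degree_leM (degree_leC _) wi).
  by have := ltn_ord i; lia.
move=> x; rewrite /eval_cube rmorphXn/=; congr (_ ^+ 2).
rewrite rmorph_sum/= horner_coef; apply: eq_bigr => i _.
rewrite rmorphM/= mevalC rmorphXn/=; congr (_ * _ ^+ _).
rewrite rmorph_sum/= /weight natr_sum; apply: eq_bigr => j _.
exact: eval_cubeX.
Qed.

Lemma weight_card (x : {ffun 'I_n -> bool}) : weight x = #|[set i | x i]%SET|.
Proof.
rewrite /weight -sum1_card [RHS]big_mkcond; apply: eq_bigr => i _.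
by rewrite inE; case: (x i).
Qed.

(** The binomial coefficient counts the k-subsets of the support of [x], so it is the sum of the
    squarefree monomials of degree [k]; these take the values 0 and 1 and equal their squares. *)
Lemma cube_sos_bin (k : nat) : cube_sos n (2 * k) (fun t => 'C(t, k)%:R : R).
Proof.
pose F (A : {set 'I_n}) : mpolynomial (R := R) n :=
  \prod_(i <- enum A) mpolyX R (mnm1 i).
exists (\sum_(A <- enum [set A : {set 'I_n} | #|A| == k]%SET) F A ^+ 2); split.
- by apply: is_SOS_sum => A; exact: is_SOS_sqr.
- rewrite big_enum_cond/=.
  rewrite /degree_le; elim/big_ind: _ => [|p q|A].
  + by rewrite mmeasure0.
  + exact: degree_leD.
  + rewrite inE => /andP[/eqP <- _]; apply: degree_le_exp.
    have := degree_le_prod (enum A) degree_leX.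
    by rewrite muln1 -cardE.
move=> x; rewrite weight_card -cards_draws -sum1_card natr_sum.
rewrite big_enum_cond/= /eval_cube rmorph_sum/=.
rewrite (bigID (fun A : {set 'I_n} => A \subset [set i | x i]%SET))/=.
rewrite [X in _ + X]big1 ?addr0 => [|A]; last first.
  move=> /andP[_ /subsetPn[i iA]]; rewrite inE => xi.
  rewrite rmorphXn rmorph_prod/= (big_rem i) ?mem_enum//=.
  by rewrite -/(eval_cube _ _) eval_cubeX (negbTE xi) mul0r expr0n.
apply: eq_big => [A|A]; first by rewrite !inE andbT andbC.
move=> /andP[_ /fintype.subsetP Ax]; rewrite rmorphXn rmorph_prod/=.
rewrite big_seq big1 ?expr1n// => i; rewrite mem_enum => /Ax; rewrite inE => xi.
by rewrite -/(eval_cube _ _) eval_cubeX xi.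
Qed.

(** On the cube, [c - |x|] is [c - n] plus the sum of the [(1 - x_i)^2]. *)
Lemma cube_sos_subr (c : R) : n%:R <= c -> cube_sos n 2 (fun t => c - t%:R).
Proof.
move=> nc.
have [s [s1 s2 s3]] : cube_sos n 2 (fun=> c - n%:R).
  by apply: (@cube_sosW 0) => //; apply: cube_sosC; rewrite subr_ge0.
pose F (i : 'I_n) : mpolynomial n := (1 - mpolyX R (mnm1 i)) ^+ 2.
exists (s + \sum_(i < n) F i); split.
- by apply: is_SOSD => //; apply: is_SOS_sum => i; exact: is_SOS_sqr.
- apply: degree_leD => //; apply: degree_le_sum => i.
  apply: (@degree_le_exp 1); apply: degree_leD.
    by apply: (@degree_leW 0) => //; rewrite -mpolyC1; exact: degree_leC.
  by rewrite /degree_le mmeasureN; exact: degree_leX.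
move=> x; rewrite /eval_cube mevalD -/(eval_cube _ _) s3.
have -> : n%:R = \sum_(i < n) 1 :> R by rewrite sumr_const card_ord.
rewrite rmorph_sum/= /weight natr_sum -addrA; congr (_ + _).
rewrite addrC -sumrB -sumrN; apply: eq_bigr => i _.
rewrite rmorphXn rmorphB rmorph1/= -/(eval_cube _ _) eval_cubeX.
by case: (x i) => /=; ring.
Qed.

End CubeSOS.

(** * The certificate *)

Lemma prod_subr_ffact (R : numDomainType) (t k : nat) :
  \prod_(i < k) (t%:R - i%:R) = (t ^_ k)%:R :> R.
Proof.
elim: k => [|k IH]; first by rewrite big_ord0.
rewrite big_ord_recr/= IH ffactnSr natrM.
have [kt|tk] := leqP k t; first by rewrite natrB.
by rewrite ffact_small// !mul0r.
Qed.

Lemma prod_ratio_bin (R : numFieldType) (t k : nat) :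
  \prod_(i < k) ((t%:R - i%:R) / i.+1%:R) = 'C(t, k)%:R :> R.
Proof.
rewrite big_split/= prodfV prod_subr_ffact -bin_ffact natrM fact_prod.
rewrite big_add1/= big_mkord natr_prod mulfK// prodf_seq_neq0.
by apply/allP => i _; rewrite pnatr_eq0.
Qed.

Lemma cube_sos_falling (R : realType) (n k : nat) :
  cube_sos n (2 * k) (fun t => \prod_(i < k) (t%:R - i%:R) : R).
Proof.
have := cube_sosM (cube_sosC n (ler0n R k`!)) (cube_sos_bin R n k).
rewrite add0n; apply: cube_sos_eq => t _.
by rewrite prod_subr_ffact -bin_ffact natrM mulrC.
Qed.

(** A weight [t - m] extends the falling factorial by one factor, and a weight [b - t] is a sum of
    squares by itself. Each costs degree 2 instead of 1, whence the final [+ 2]. *)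
Lemma interval_sos_cube_sos (R : realType) (n m D : nat) (b : R) (p : {poly R}) :
  n%:R <= b -> interval_sos m%:R b D p ->
  cube_sos n (D + 2 * m + 2)
    (fun t => p.[t%:R] * \prod_(i < m) (t%:R - i%:R)).
Proof.
move=> nb; elim=> [g e1 e2 h|u v _ hu _ hv]; last first.
  by apply: cube_sos_eq (cube_sosD hu hv) => t _; rewrite hornerD mulrDl.
have hb : cube_sos n (2 * e2) (fun t => (b - t%:R) ^+ e2).
  case: {h} e2; last by apply: cube_sos_eq (cube_sosC n ler01) => t _.
  by apply: cube_sos_eq (cube_sos_subr nb) => t _; rewrite expr1.
have := cube_sosM (cube_sosM (cube_sos_sqr n g) hb)
                  (@cube_sos_falling R n (m + e1)).
have dD : (2 * (size g).-1 + 2 * e2 + 2 * (m + e1) <= D + 2 * m + 2)%N.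
  by move: h; case: e1; case: e2 {hb} => /=; lia.
move=> /(cube_sosW dD); apply: cube_sos_eq => t _.
rewrite !hornerM !horner_exp !hornerE.
case: e1 {h dD}; last by rewrite addn0 expr0 mulr1.
by rewrite addn1 big_ord_recr/= expr1; ring.
Qed.

Section Certificate.
Variables (R : realType) (n m B r : nat) (q : R) (l : nat -> nat).
Hypothesis m_gt0 : (0 < m)%N.
Hypothesis mn : (m <= n)%N.
Hypothesis qm : m%:R - 1 < q < m%:R.
Hypothesis mB : (2 * m <= 2 ^ B)%N.
Hypothesis rq : 1 <= 2 ^+ r * (q - (m%:R - 1)).
Hypothesis lN : forall i, 8 * (n.+2)%:R <= i.+1%:R * (2 * l i + 1)%N%:R ^+ 2 :> R.

Let N : R := n.+2%:R.
Let d := (m + (2 + B + B) * (\sum_(i < m) l i) + r * l 0)%N.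
Let c (k : nat) : R := (m%:R - k%:R) / (q - k%:R).

Let q_gt k : (k < m)%N -> 0 < q - k%:R.
Proof.
move=> km; case/andP: qm => q1 _; rewrite subr_gt0 (le_lt_trans _ q1)//.
by rewrite lerBrDr natr1 ler_nat.
Qed.

Let c_ge0 k : (k < m)%N -> 0 <= c k.
Proof.
by move=> km; rewrite divr_ge0 ?(ltW (q_gt km))// subr_ge0 ler_nat ltnW.
Qed.

(** Numerator and denominator share the part [m - 1 - k]; what is left is 1 against
    [q - (m-1) >= 2^-r]. *)
Let c_le k : (k < m)%N -> c k <= 2 ^+ r.
Proof.
move=> km; rewrite ler_pdivrMr ?q_gt//.
have r1 : 1 <= 2 ^+ r :> R by rewrite exprn_ege1// ler1n.
have k1 : 0 <= m%:R - 1 - k%:R :> R.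
  by rewrite subr_ge0 lerBrDr natr1 ler_nat.
have := rq; have := ler_wpM2r k1 r1; lra.
Qed.

(* s1 takes the value (m - k) / (q - k) at k < m, which forces
   |x| - m = s1 (|x| - q) there. *)
Lemma interpolating_multiplier :
  exists s1 : {poly R},
    [/\ (size s1 <= (2 * d).+1)%N,
        cube_sos n (2 * d) (fun t => s1.[t%:R]),
        forall j, (j <= m)%N -> s1.[j%:R] * (j%:R - q) = j%:R - m%:R &
        forall t, m.+1%:R <= t <= N -> 0 <= s1.[t] <= 2^-1].
Proof.
have N0 : 0 < N by rewrite ltr0n.
have B0 : (0 < B)%N by rewrite lt0n; apply/eqP => B0; move: mB; rewrite B0; lia.
have mB' : (m <= 2 ^ B)%N by apply: leq_trans mB; lia.
have sel (k : 'I_m) := damped_selector N0 lN r (ltn_ord k) mB' B0.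
have [F FP] := choice sel.
pose bin (k : nat) : {poly R} := \prod_(i < k) (('X - i%:R%:P) * (i.+1%:R^-1)%:P).
have binE k t : (bin k).[t] = \prod_(i < k) ((t - i%:R) / i.+1%:R).
  by rewrite horner_prod; apply: eq_bigr => i _; rewrite !hornerE.
have sbin k : (size (bin k) <= k.+1)%N.
  rewrite -[X in (_ <= X.+1)%N]card_ord -[X in (_ <= X.+1)%N]sum1_card.
  apply: (size_prod_leq_sum _ (d := fun=> 1%N)) => i.
  rewrite mulrC mul_polyC (leq_trans (size_scale_leq _ _))//.
  by rewrite size_XsubC.
pose s1 : {poly R} := \sum_(k < m) (c k)%:P * (bin k * F k ^+ 2).
have s1E t : s1.[t] = \sum_(k < m) c k * ((bin k).[t] * (F k).[t] ^+ 2).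
  rewrite horner_sum; apply: eq_bigr => k _.
  by rewrite hornerM hornerC hornerM horner_exp.
(* The binomial coefficient costs degree [2k] on the cube and [F k ^+ 2] at most [2(d-k)], so every
   term fits into [2d]. *)
have sF (k : 'I_m) : (size (F k) <= (d - k).+1)%N.
  have [sF _ _ _] := FP k; apply: leq_trans sF _.
  by have := ltn_ord k; rewrite /d; lia.
have kd (k : 'I_m) : (k <= d)%N.
  by have := ltn_ord k; rewrite /d; lia.
exists s1; split.
- apply: (leq_trans (size_sum _ _ _)); apply/bigmax_leqP => k _.
  rewrite mul_polyC (leq_trans (size_scale_leq _ _))//.
  apply: leq_trans (size_mul_leqS (sbin k) (size_exp_leqS 2 (sF k))) _.
  by have := kd k; lia.
- have h (k : 'I_m) : cube_sos n (2 * d)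
      (fun t => c k * ((bin k).[t%:R] * (F k).[t%:R] ^+ 2)).
    have := cube_sosM (cube_sosC n (c_ge0 (ltn_ord k)))
              (cube_sosM (cube_sos_bin R n k) (cube_sos_sqr n (F k))).
    have D : (0 + (2 * k + 2 * (size (F k)).-1) <= 2 * d)%N.
      by have := kd k; have := sF k; case: (size (F k)) => [|s] /=; lia.
    move=> /(cube_sosW D); apply: cube_sos_eq => t _.
    by rewrite binE prod_ratio_bin.
  by apply: cube_sos_eq (cube_sos_sum (index_enum 'I_m) h) => t _; rewrite s1E.
- move=> j jm.
  (* Terms with [k < j] vanish through [F k], those with [k > j] through the binomial
     coefficient. *)
  have offdiag (k : 'I_m) : (k : nat) != j ->
      c k * ((bin k).[j%:R] * (F k).[j%:R] ^+ 2) = 0.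
    rewrite neq_ltn => /orP[kj|jk].
      by have [_ _ -> //] := FP k; rewrite ?kj// expr0n/= !mulr0.
    by rewrite binE prod_ratio_bin bin_small// mul0r mulr0.
  move: jm; rewrite leq_eqVlt => /orP[/eqP jm|jm].
    rewrite s1E big1 => [|k _]; first by rewrite jm subrr mul0r.
    by apply: offdiag; rewrite jm neq_ltn ltn_ord.
  rewrite s1E (bigD1 (Ordinal jm))//= big1 ?addr0; last first.
    by move=> k kj; apply: offdiag.
  have [_ -> _ _] := FP (Ordinal jm).
  rewrite binE prod_ratio_bin binn expr1n !mulr1 /c.
  have := q_gt jm; rewrite -[j%:R - q]opprB => /gt_eqF/negbT qj.
  by rewrite mulrN divfK// opprB.
move=> t mtN; have /andP[mt tN] := mtN.
have term (k : 'I_m) : 0 <= c k * ((bin k).[t] * (F k).[t] ^+ 2)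
    <= 2 ^+ r * 4^-1 ^+ (B + r).
  have bin0 : 0 <= (bin k).[t].
    rewrite binE prodr_ge0// => i _; rewrite divr_ge0// subr_ge0.
    apply: le_trans mt; rewrite ler_nat.
    by have := ltn_ord i; have := ltn_ord k; lia.
  have bF0 : 0 <= (bin k).[t] * (F k).[t] ^+ 2 by rewrite mulr_ge0// sqr_ge0.
  rewrite mulr_ge0 ?c_ge0//= ler_pM ?c_ge0 ?c_le//.
  by have [_ _ _ /(_ _ mtN)] := FP k; rewrite binE.
rewrite s1E sumr_ge0/= => [|k _]; last by case/andP: (term k).
apply: (@le_trans _ _ (\sum_(k < m) 2 ^+ r * 4^-1 ^+ (B + r))).
  by apply: ler_sum => k _; case/andP: (term k).
rewrite sumr_const card_ord exprD.
have -> : 4^-1 = 2^-1 * 2^-1 :> R by rewrite -invfM; congr (_^-1); ring.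
rewrite !exprMn.
have two (k : nat) : 0 <= (2^-1 : R) ^+ k <= 1.
  by rewrite exprn_ge0 ?invr_ge0// exprn_ile1// ?invr_ge0// invf_le1// ler1n.
have rr : 2 ^+ r * 2^-1 ^+ r = 1 :> R by rewrite -exprMn divff ?expr1n.
have BB : 2 * m%:R * 2^-1 ^+ B <= 1 :> R.
  rewrite exprVn ler_pdivrMr ?exprn_gt0// mul1r -natrM -natrX ler_nat.
  exact: mB.
have /andP[B0' B1] := two B; have /andP[r0' r1] := two r.
move: rr BB B0' B1 r0' r1.
move: (2^-1 ^+ B) (2^-1 ^+ r) (2 ^+ r) => x y z rr BB B0' B1 r0' r1.
(* One [2^-B] pays for the [m] terms with a factor 1/2 to spare, and one [2^-r] pays for the
   coefficients [c k]. *)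
rewrite -[leLHS]mulr_natl (_ : m%:R * _ = 2^-1 * (2 * m%:R * x) * x * (z * y) * y);
  last by field.
rewrite rr mulr1 -mulrA -mulrA ler_piMr// mulr_ile1//.
- by rewrite mulr_ge0.
- exact: mulr_ge0.
- exact: mulr_ile1.
Qed.

(** The remainder vanishes at 0, ..., m, and its cofactor is nonnegative on [m+1, n+2]. The degree
    exceeds [d] by [m + 2] because of the falling factorial of length [m + 1] and the interval
    weights in [s0]. *)
Lemma MK_certificate_damped :
  MK_certificate n q
    (2 * m + 2 + (2 + B + B) * (\sum_(i < m) l i) + r * l 0).
Proof.
have [s1 [ss1 [S1 [S1sos S1deg S1val]] s1v s1b]] := interpolating_multiplier.
have cq : Num.ceil q = m%:Z.
  apply/eqP; rewrite ceil_eq; case/andP: qm => h1 h2.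
  by rewrite rmorphB/= h1 ltW.
pose p : {poly R} := 'X - m%:R%:P - s1 * ('X - q%:P).
have pE t : p.[t] = t - m%:R - s1.[t] * (t - q) by rewrite !hornerE.
have sp : (size p <= (2 * d).+2)%N.
  rewrite (leq_trans (size_polyD _ _))// geq_max size_XsubC/= size_polyN.
  have sX : (size ('X - q%:P)%R <= 2)%N by rewrite size_XsubC.
  by apply: leq_trans (size_mul_leqS ss1 sX) _; rewrite addn1.
pose rs : seq R := [seq (i : nat)%:R | i <- iota 0 m.+1].
have [A pA] : exists A, p = A * \prod_(z <- rs) ('X - z%:P).
  apply: uniq_roots_prod_XsubC.
    apply/allP => z /mapP[i]; rewrite mem_iota ltnS => /andP[_ im] ->.
    by rewrite /root pE s1v// subrr.
  rewrite uniq_rootsE map_inj_uniq ?iota_uniq//.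
  by move=> i j /eqP; rewrite eqr_nat => /eqP.
have rsE t : (\prod_(z <- rs) ('X - z%:P)).[t] = \prod_(i < m.+1) (t - i%:R).
  rewrite big_map -[iota 0 m.+1]/(index_iota 0 m.+1) big_mkord horner_prod.
  by apply: eq_bigr => i _; rewrite !hornerE.
have sA : (size A <= (2 * d).+2)%N.
  have [->|A0] := eqVneq A 0; first by rewrite size_poly0.
  apply: leq_trans sp; rewrite pA size_Mmonic ?monic_prod_XsubC//.
  by rewrite size_prod_XsubC addnS/= leq_addr.
(* The right endpoint [n+2] keeps the interval nondegenerate when [m = n]. *)
have mN : m.+1%:R < N by rewrite ltr_nat ltnS.
have A0 t : m.+1%:R <= t <= N -> 0 <= A.[t].
  move=> mtN; have /andP[mt tN] := mtN.
  have pos : 0 < \prod_(i < m.+1) (t - i%:R).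
    apply: prodr_gt0 => i _; rewrite subr_gt0; apply: lt_le_trans mt.
    by rewrite ltr_nat ltn_ord.
  rewrite -(pmulr_lge0 _ pos) -rsE -hornerM -pA pE subr_ge0.
  have /andP[s10 s12] := s1b t mtN; case/andP: qm => qm1 qm2.
  have mt' : m%:R + 1 <= t by rewrite natr1.
  have tq : 0 <= t - q by lra.
  (* From [q > m-1] and [t >= m+1] it follows that [t - q <= t - m + 1 <= 2 (t - m)], so a
     multiplier of at most 1/2 is small enough. *)
  by apply: le_trans (ler_wpM2r tq s12) _; lra.
have nN : n%:R <= N by rewrite ler_nat; lia.
have [S0 [S0sos S0deg S0val]] :=
  interval_sos_cube_sos nN (nonneg_interval_sos mN sA A0).
exists S0, S1; split=> //.
- by apply: degree_leW S0deg; rewrite /d; lia.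
- by apply: degree_leW S1deg; rewrite /d; lia.
move=> x; rewrite S0val S1val cq -rsE -hornerM -pA pE.
by rewrite pmulrn; ring.
Qed.

End Certificate.

(** * The bound on the rank *)

(** Each term is at most twice an increment of the square root. The sum controls the total degree of
    kernels of degree about [sqrt (n/(i+1))]. *)
Lemma sum_invsqrt_le (R : rcfType) (m : nat) :
  \sum_(i < m) (Num.sqrt i.+1%:R)^-1 <= 2 * Num.sqrt m%:R :> R.
Proof.
elim: m => [|m IH]; first by rewrite big_ord0 sqrtr0 mulr0.
rewrite big_ord_recr/=.
have : Num.sqrt m%:R ^+ 2 = m%:R :> R by rewrite sqr_sqrtr.
have : Num.sqrt m.+1%:R ^+ 2 = m%:R + 1 :> R by rewrite sqr_sqrtr// natr1.
have : 0 < Num.sqrt m.+1%:R :> R by rewrite sqrtr_gt0.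
move: IH (sqrtr_ge0 (m%:R : R)); move: (\sum_(i < m) _) => S.
move: (Num.sqrt m%:R) (Num.sqrt m.+1%:R) => a b Sa a0 b0 b2 a2.
suff : b^-1 <= 2 * b - 2 * a by lra.
rewrite -(ler_pM2l b0) divff ?gt_eqF//.
have := sqr_ge0 (b - a); nra.
Qed.

Lemma ln2_ge (R : realType) : 2^-1 <= ln 2 :> R.
Proof.
have := @le_ln1Dx R (- 2^-1).
have -> : 1 + - 2^-1 = 2^-1 :> R by field.
rewrite lnV ?posrE// => h; have := h ltac:(lra); lra.
Qed.

Lemma ln_le_sqrt (R : realType) (x : R) : 0 < x -> ln x <= 2 * Num.sqrt x.
Proof.
move=> x0; have s0 : 0 < Num.sqrt x by rewrite sqrtr_gt0.
rewrite -{1}[x]sqr_sqrtr ?ltW// expr2 lnM ?posrE//.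
have := @le_ln1Dx R (Num.sqrt x - 1).
have -> : 1 + (Num.sqrt x - 1) = Num.sqrt x by ring.
move=> h; by have := h ltac:(lra); lra.
Qed.

Lemma up_log2_le (R : realType) (k : nat) : (0 < k)%N ->
  (up_log 2 k)%:R <= 1 + 2 * ln k%:R :> R.
Proof.
move=> k0; have lnk : 0 <= ln k%:R :> R by rewrite ln_ge0// ler1n.
case: (posnP (up_log 2 k)) => [->|u0]; first by rewrite addr_ge0// mulr_ge0.
have k1 : (1 < k)%N.
  by rewrite ltnNge; apply: contraL u0; rewrite -leqNgt leqn0 up_log_eq0.
have /andP[h _] := up_log_bounds (isT : (1 < 2)%N) k1.
have h1 : (up_log 2 k).-1%:R * ln 2 <= ln k%:R :> R.
  rewrite mulr_natl -lnXn// ler_ln ?posrE ?exprn_gt0 ?ltr0n//.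
  by rewrite -natrX ler_nat ltnW.
have -> : (up_log 2 k)%:R = (up_log 2 k).-1%:R + 1 :> R by rewrite natr1 prednK.
have h2 : (up_log 2 k).-1%:R * 2^-1 <= (up_log 2 k).-1%:R * ln 2 :> R.
  by rewrite ler_wpM2l// ln2_ge.
lra.
Qed.

Section RankBound.
Variables (R : realType) (n : nat).

Lemma SOS_rank_certificate (q : R) (d : nat) :
  MK_certificate n q d -> (SOS_rank n q <= d%:R%:E)%E.
Proof.
move=> h; rewrite /SOS_rank; case: ifP => _; last by rewrite lee_fin.
by apply: ereal_inf_lbound; exists d.
Qed.

Lemma SOS_rank_ge0 (q : R) : (0 <= SOS_rank n q)%E.
Proof.
rewrite /SOS_rank; case: ifP => // _; apply: le_ereal_inf_tmp => _ [d _ <-].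
by rewrite lee_fin.
Qed.

Lemma SOS_rank_outside (q : R) : ~~ (0 <= q <= n%:R) -> SOS_rank n q = 0%E.
Proof. by rewrite /SOS_rank => /negbTE ->. Qed.

(** The objective gap is then the constraint itself, so [s0 = 0] and [s1 = 1] work. *)
Lemma SOS_rank_integer (q : R) : q = (Num.ceil q)%:~R -> SOS_rank n q = 0%E.
Proof.
move=> qc; apply/eqP; rewrite eq_le SOS_rank_ge0 andbT.
apply: (@SOS_rank_certificate q 0); exists 0, 1; split.
- by exists [::]; rewrite big_nil.
- by exists [:: 1]; rewrite big_seq1 expr1n.
- by rewrite /degree_le mmeasure0.
- by rewrite /degree_le mmeasure1.
by move=> x; rewrite /eval_cube meval0 meval1 add0r mul1r {2}qc.
Qed.

Lemma SOS_rank_le (m r : nat) (q : R) :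
  (0 < m <= n)%N -> m%:R - 1 < q < m%:R -> 1 <= 2 ^+ r * (q - (m%:R - 1)) ->
  (SOS_rank n q <=
     (100 * Num.sqrt n%:R * (Num.sqrt m%:R * ln (2 * m)%N%:R + r%:R))%:E)%E.
Proof.
move=> /andP[m0 mn] qm rq.
pose B := up_log 2 (2 * m).
(* The choice [l^2 > 2(n+2)/(i+1)] gives [(i+1)(2l)^2 > 8(n+2)], as the kernels require. *)
pose l (i : nat) : nat := (Num.truncn (Num.sqrt (2 * n.+2%:R / i.+1%:R : R))).+1.
have mB : (2 * m <= 2 ^ B)%N by apply: up_logP.
have lN i : 8 * n.+2%:R <= i.+1%:R * (2 * l i + 1)%N%:R ^+ 2 :> R.
  set x : R := 2 * n.+2%:R / i.+1%:R.
  have x0 : 0 <= x by rewrite divr_ge0// mulr_ge0.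
  have sx : Num.sqrt x < (l i)%:R.
    by have /andP[_] := truncn_itv (sqrtr_ge0 x).
  have -> : 8 * n.+2%:R = i.+1%:R * (4 * Num.sqrt x ^+ 2) :> R.
    rewrite sqr_sqrtr// /x; field.
    by rewrite nat1r pnatr_eq0.
  rewrite ler_wpM2l// natrD natrM.
  have := sqrtr_ge0 x; move: sx; move: (Num.sqrt x) ((l i)%:R) => a b; nra.
have := SOS_rank_certificate (MK_certificate_damped m0 mn qm mB rq lN).
move=> /le_trans; apply; rewrite lee_fin.
have n0 : (0 < n)%N by apply: leq_trans mn.
set s := Num.sqrt n%:R; set t := Num.sqrt m%:R; set g := ln (2 * m)%N%:R.
have s1 : 1 <= s by rewrite -[1]sqrtr1 ler_sqrt// ler1n.
have t1 : 1 <= t by rewrite -[1]sqrtr1 ler_sqrt// ler1n.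
have ts : t <= s by rewrite ler_sqrt// ler_nat.
have tm : m%:R = t * t by rewrite -expr2 sqr_sqrtr.
have li i : (l i)%:R <= 3 * s * (Num.sqrt i.+1%:R)^-1 + 1.
  rewrite /l -natr1 lerD2r.
  have /andP[h _] := truncn_itv (sqrtr_ge0 (2 * n.+2%:R / i.+1%:R : R)).
  apply: le_trans h _.
  (* The 3 comes from [2(n+2) <= 9n] for [n >= 1]. *)
  have -> : 3 * s * (Num.sqrt i.+1%:R)^-1 = Num.sqrt (9 * n%:R / i.+1%:R).
    rewrite sqrtrM ?mulr_ge0// sqrtrM// sqrtrV//; congr (_ * _ * _).
    by rewrite -[9]/(9%:R) (_ : 9%:R = 3 ^+ 2 :> R) ?sqrtr_sqr ?ger0_norm// -natrX.
  rewrite ler_sqrt ?divr_ge0 ?mulr_ge0// ler_wpM2r// -!natrM ler_nat.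
  by move: n0; clear; lia.
have l0 : (l 0)%:R <= 4 * s by have := li 0%N; rewrite sqrtr1 invr1; lra.
have sl : \sum_(i < m) (l i)%:R <= 7 * s * t.
  apply: (@le_trans _ _ (\sum_(i < m) (3 * s * (Num.sqrt i.+1%:R)^-1 + 1))).
    by apply: ler_sum => i _.
  rewrite big_split/= -mulr_sumr sumr_const card_ord tm.
  have s0 : 0 <= 3 * s by lra.
  have := ler_wpM2l s0 (sum_invsqrt_le R m); rewrite -/t.
  move: (\sum_(i < m) _) => S; nra.
have gB : B%:R <= 1 + 2 * g by apply: up_log2_le; rewrite muln_gt0.
have g2 : 2^-1 <= g.
  apply: le_trans (ln2_ge R) _; rewrite ler_ln ?posrE// ?ltr0n ?muln_gt0//.
  by rewrite ler_nat leq_pmulr.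
rewrite !natrD !natrM natr_sum tm !natrD.
have r0 : 0 <= r%:R :> R by [].
have B0 : 0 <= B%:R :> R by [].
(* As [g >= 1/2], multiples of [s t] are absorbed into [s t g]; the total is at most
   [92 s t g + 4 s r], rounded up to 100. *)
have a1 : (2 + B%:R + B%:R) * \sum_(i < m) (l i)%:R
    <= (4 + 4 * g) * (7 * s * t).
  rewrite ler_pM ?sumr_ge0//; lra.
have a2 : r%:R * (l 0)%:R <= r%:R * (4 * s) by rewrite ler_wpM2l.
have a3 : 2 * (t * t) <= 2 * (s * t) by rewrite ler_pM2l// ler_wpM2r//; lra.
have a4 : 1 <= s * t by rewrite mulr_ege1.
have a5 : s * t * 2^-1 <= s * t * g by rewrite ler_wpM2l//; lra.
have a6 : 0 <= s * r%:R by rewrite mulr_ge0//; lra.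
nra.
Qed.

End RankBound.

(** * Gaussian estimates *)

(** The Radon-Nikodym derivative agrees almost everywhere with the density, since both have the same
    integral over every measurable set. *)
Lemma ge0_integral_normal_prob (R : realType) (m s : R) (f : R -> \bar R) :
  (forall x, 0 <= f x)%E -> measurable_fun [set: R] f ->
  (\int[normal_prob m s]_x f x =
   \int[lebesgue_measure]_x (f x * (normal_pdf m s x)%:E))%E.
Proof.
move=> f0 mf; have dom := normal_prob_dominates m s.
rewrite -(Radon_Nikodym_SigmaFinite.change_of_variables dom f0)//=.
apply: ae_eq_integral => //=.
- apply: emeasurable_funM => //.
  exact: measurable_int (Radon_Nikodym_SigmaFinite.f_integrable dom).
- apply: emeasurable_funM => //; apply/measurable_EFinP.
  exact: measurable_normal_pdf.
- apply: ae_eqe_mul2l; apply: integral_ae_eq => //=.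
  + exact: Radon_Nikodym_SigmaFinite.f_integrable.
  + by apply/measurable_EFinP; exact: measurable_normal_pdf.
  + by move=> A _ mA; rewrite -Radon_Nikodym_SigmaFinite.f_integral.
Qed.

Lemma normal_peak_le (R : realType) (s : R) : 0 < s -> normal_peak s <= s^-1.
Proof.
move=> s0; rewrite /normal_peak.
have s20 : 0 < s ^+ 2 by rewrite exprn_gt0.
have h : s ^+ 2 <= s ^+ 2 * pi *+ 2.
  by have := pi_ge2 R; rewrite -mulr_natr; nra.
rewrite [X in _ <= X^-1](_ : s = Num.sqrt (s ^+ 2)); last first.
  by rewrite sqrtr_sqr gtr0_norm.
have p0 : 0 < s ^+ 2 * pi *+ 2 by apply: lt_le_trans h.
by rewrite lef_pV2 ?posrE ?sqrtr_gt0// ler_sqrt// ltW.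
Qed.

(** The exponential is weakened to [1/(1+z)] with [z >= y^2/2], and [1 + a^2 <= 6 (1 + y^2/2)] on
    the unit interval. Quadratic decay is summable over integer translates, uniformly in [q]. *)
Lemma normal_pdf_le (R : realType) (s a y : R) : 0 < s < 1 -> a <= y <= a + 1 ->
  normal_pdf 0 s y <= 6 / (s * (1 + a ^+ 2)).
Proof.
move=> /andP[s0 s1] /andP[ay ya].
rewrite normal_pdfE ?gt_eqF// /normal_fun subr0 invfM [6 * _]mulrCA.
apply: ler_pM; rewrite ?normal_peak_ge0 ?expR_ge0 ?normal_peak_le//.
set z := y ^+ 2 / (s ^+ 2 *+ 2).
have s20 : 0 < s ^+ 2 by rewrite exprn_gt0.
have zy : y ^+ 2 / 2 <= z.
  rewrite /z ler_wpM2l ?sqr_ge0// lef_pV2 ?posrE ?mulrn_wgt0//.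
  by rewrite -mulr_natr ler_piMl// exprn_ile1// ltW.
have y20 := sqr_ge0 y.
have ez : 1 + z <= expR z := expR_ge1Dx z.
have z1 : 0 < 1 + z by lra.
rewrite mulNr expRN.
apply: (@le_trans _ _ (1 + z)^-1); first by rewrite lef_pV2 ?posrE ?expR_gt0.
have a0 : 0 < 1 + a ^+ 2 by rewrite ltr_pwDl// sqr_ge0.
rewrite ler_pdivlMr// mulrC ler_pdivrMr//.
have h1 : 0 <= (y - a) * (1 - (y - a)) by rewrite mulr_ge0; lra.
have h2 := sqr_ge0 (y + (y - a)).
have h3 : 1 + a ^+ 2 <= 6 + 3 * y ^+ 2 by nra.
by lra.
Qed.

Lemma normal_prob_itv_le (R : realType) (s a t : R) : 0 < s < 1 -> 0 <= t <= 1 ->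
  (normal_prob 0%R s `[a, (a + t)%R[%classic <=
     (t * (6 / (s * (1 + a ^+ 2))))%:E)%E.
Proof.
move=> s01 /andP[t0 t1]; rewrite /normal_prob.
apply: (@le_trans _ _ (\int[lebesgue_measure]_(x in `[a, (a + t)%R[)
    (6 / (s * (1 + a ^+ 2)))%:E)%E).
  apply: ge0_le_integral => //=.
  - by move=> x _; rewrite lee_fin normal_pdf_ge0.
  - apply/measurable_funTS/measurable_EFinP; exact: measurable_normal_pdf.
  move=> x; rewrite in_itv/= => /andP[ax xa].
  by rewrite lee_fin normal_pdf_le// ax/= (le_trans (ltW xa))// lerD2l.
rewrite integral_cst//= lebesgue_measure_itv/= lte_fin ltrDl.
case: ifPn => [_|]; last first.
  rewrite -leNgt => t0'; have -> : t = 0 by lra.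
  by rewrite mule0 mul0r.
by rewrite -EFinB [(a + t)%R]addrC addrK -EFinM mulrC.
Qed.

(** Half of the exponent absorbs [y^2], by [z exp(-z) <= 1]; the other half is a Gaussian of doubled
    variance, whose integral is 1. *)
Lemma sqr_normal_pdf_le (R : realType) (s y : R) : 0 < s < 1 ->
  y ^+ 2 * normal_pdf 0 s y <= 8 * normal_pdf 0 (Num.sqrt 2 * s) y.
Proof.
move=> /andP[s0 s1].
have s2 : 0 < Num.sqrt 2 :> R by rewrite sqrtr_gt0.
have ss0 : 0 < Num.sqrt 2 * s by rewrite mulr_gt0.
rewrite !normal_pdfE ?gt_eqF// /normal_fun subr0.
have -> : (Num.sqrt 2 * s) ^+ 2 = 2 * s ^+ 2 by rewrite exprMn sqr_sqrtr.
have -> : normal_peak (Num.sqrt 2 * s) = (Num.sqrt 2)^-1 * normal_peak s.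
  rewrite /normal_peak -invfM -sqrtrM//; congr (Num.sqrt _)^-1.
  by rewrite exprMn sqr_sqrtr//; ring.
have r2 : Num.sqrt 2 <= 2 :> R.
  by rewrite -[leRHS]ger0_norm// -sqrtr_sqr ler_sqrt//; lra.
set p := normal_peak s; have p0 : 0 <= p := normal_peak_ge0 s.
have s20 : 0 < s ^+ 2 by rewrite exprn_gt0.
rewrite -[s ^+ 2 *+ 2]mulr_natl -[(2 * s ^+ 2) *+ 2]mulr_natl.
pose z := y ^+ 2 / (4 * s ^+ 2).
have yz : y ^+ 2 = 4 * s ^+ 2 * z by rewrite /z mulrC divfK// gt_eqF// mulr_gt0.
have -> : - y ^+ 2 / (2 * (2 * s ^+ 2)) = - z.
  by rewrite /z mulNr mulrA -natrM.
have -> : - y ^+ 2 / (2 * s ^+ 2) = - z - z.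
  by rewrite yz; field; rewrite gt_eqF.
have z0 : 0 <= z by rewrite divr_ge0 ?sqr_ge0// mulr_ge0// ltW.
rewrite expRD; set e := expR (- z).
have e0 : 0 < e := expR_gt0 _.
have ze : z * e <= 1.
  rewrite /e expRN ler_pdivrMr ?expR_gt0// mul1r.
  by have := expR_ge1Dx z; lra.
have s21 : s ^+ 2 <= 1 by rewrite exprn_ile1// ltW.
have i2 : 1 <= 2 * (Num.sqrt 2)^-1 :> R by rewrite ler_pdivlMr// mul1r.
have -> : y ^+ 2 * (p * (e * e)) = 4 * (s ^+ 2 * (z * e)) * (p * e).
  by rewrite yz; ring.
have -> : 8 * ((Num.sqrt 2)^-1 * p * e) = 4 * (2 * (Num.sqrt 2)^-1) * (p * e).
  by ring.
rewrite ler_wpM2r ?mulr_ge0// ?(ltW e0)// ler_wpM2l//.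
by rewrite (le_trans _ i2)// mulr_ile1// ?(ltW s20)// mulr_ge0// ltW.
Qed.

Lemma normal_second_moment_le (R : realType) (s : R) : 0 < s < 1 ->
  (\int[normal_prob 0%R s]_y (y ^+ 2)%:E <= 8%:E)%E.
Proof.
move=> s01; rewrite ge0_integral_normal_prob; first last.
- by apply/measurable_EFinP; exact: measurable_funX.
- by move=> y; rewrite lee_fin sqr_ge0.
rewrite -[leRHS]mule1 -(integral_normal_pdf 0 (Num.sqrt 2 * s)).
rewrite -ge0_integralZl//=; last 2 first.
- by apply/measurable_EFinP; exact: measurable_normal_pdf.
- by move=> x _; rewrite lee_fin normal_pdf_ge0.
apply: ge0_le_integral => //=.
- by move=> y _; rewrite -EFinM lee_fin mulr_ge0 ?sqr_ge0 ?normal_pdf_ge0.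
- apply: emeasurable_funM; apply/measurable_EFinP; first exact: measurable_funX.
  exact: measurable_normal_pdf.
- apply: emeasurable_funM => //; apply/measurable_EFinP.
  exact: measurable_normal_pdf.
- by move=> y _; rewrite -!EFinM lee_fin sqr_normal_pdf_le.
Qed.

(* x / (1 + |x|) is an increasing bounded function whose increments dominate
   the summands. *)
Lemma sum_inv1Dsqr_le (R : realFieldType) (n : nat) (q : R) :
  \sum_(j < n) (1 + (j%:R - q) ^+ 2)^-1 <= 8.
Proof.
pose g (x : R) := x / (1 + `|x|).
have d0 (x : R) : 0 < 1 + `|x| by rewrite ltr_pwDl.
have gb x : `|g x| <= 1.
  rewrite normrM normfV (gtr0_norm (d0 _)) ler_pdivrMr// mul1r lerDr//.
have step x : (1 + x ^+ 2)^-1 <= 4 * (g (x + 1) - g x).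
  have c0 : 0 < 1 + x ^+ 2 by rewrite ltr_pwDl// sqr_ge0.
  have ab0 : 0 < (1 + `|x + 1|) * (1 + `|x|) by rewrite mulr_gt0.
  have -> : 4 * (g (x + 1) - g x) = 4 * ((x + 1) * (1 + `|x|) -
      x * (1 + `|x + 1|)) / ((1 + `|x + 1|) * (1 + `|x|)).
    by rewrite /g; field; rewrite !gt_eqF.
  rewrite ler_pdivlMr// mulrC ler_pdivrMr//.
  have [x0|x0] := leP 0 x.
    have x1 : 0 <= x + 1 by lra.
    rewrite !ger0_norm//; nra.
  have [x1|x1] := leP 0 (x + 1).
    rewrite (ger0_norm x1) (ltr0_norm x0); nra.
  rewrite (ltr0_norm x0) (ltr0_norm x1); nra.
have tel : \sum_(j < n) (1 + (j%:R - q) ^+ 2)^-1 <= 4 * (g (n%:R - q) - g (- q)).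
  elim: n => [|n IH]; first by rewrite big_ord0 sub0r subrr mulr0.
  rewrite big_ord_recr/=; have := step (n%:R - q).
  have -> : n%:R - q + 1 = n.+1%:R - q by rewrite -natr1; ring.
  by move: IH; lra.
apply: le_trans tel _.
have := gb (n%:R - q); have := gb (- q); rewrite !ler_norml.
by move=> /andP[? ?] /andP[? ?]; lra.
Qed.

(** * The rank of the perturbed instance *)

(** Split [sqrt m <= sqrt q + (1 + |y|)]. The first part takes [ln (2m) <= 2 ln n]; the second takes
    [ln (2m) <= 3 sqrt m], so that the noise multiplies no [ln n] and enters only through its second
    moment. *)
Lemma sqrt_mul_ln_le (R : realType) (n m : nat) (q y : R) :
  (1 < n)%N -> (0 < m <= n)%N -> 0 <= q -> m%:R <= q + (1 + `|y|) ->
  Num.sqrt m%:R * ln (2 * m)%N%:R <=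
    2 * (Num.sqrt q * ln n%:R) + 6 * (1 + Num.sqrt q) * (1 + y ^+ 2).
Proof.
move=> n1 /andP[m0 mn] q0 mq.
set a := Num.sqrt m%:R; set g := ln (2 * m)%N%:R; set s := Num.sqrt q.
have s0 : 0 <= s by exact: sqrtr_ge0.
have Y0 := normr_ge0 y; have Y2 : `|y| ^+ 2 = y ^+ 2 := real_normK (num_real y).
have m2 : (0 : R) < (2 * m)%N%:R by rewrite ltr0n muln_gt0.
have g0 : 0 <= g by rewrite ln_ge0// ler1n muln_gt0.
have as_ : a <= s + (1 + `|y|).
  have u0 : 0 <= s + (1 + `|y|) by rewrite !addr_ge0.
  rewrite -[leRHS]ger0_norm// -sqrtr_sqr ler_sqrt ?sqr_ge0// (le_trans mq)//.
  have : s ^+ 2 = q by rewrite sqr_sqrtr.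
  by move: Y0 s0; move: (`|y|) => Y; nra.
have gn : g <= 2 * ln n%:R.
  have n0 : (0 : R) < n%:R by rewrite ltr0n ltnW.
  rewrite mulr_natl -lnXn// ler_ln ?posrE ?exprn_gt0// -natrX ler_nat.
  by rewrite -mulnn leq_mul.
have ga : g <= 3 * a.
  apply: le_trans (ln_le_sqrt m2) _.
  have b2 : Num.sqrt (2 * m)%N%:R ^+ 2 = 2 * a ^+ 2.
    by rewrite /a !sqr_sqrtr// natrM.
  rewrite -(@ler_pXn2r _ 2) ?nnegrE ?mulr_ge0 ?sqrtr_ge0// !exprMn b2.
  by have := sqr_ge0 a; lra.
apply: (@le_trans _ _ ((s + (1 + `|y|)) * g)); first by rewrite ler_wpM2r.
rewrite mulrDl lerD//; first by rewrite mulrCA; apply: ler_wpM2l.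
apply: (@le_trans _ _ ((1 + `|y|) * (3 * (s + (1 + `|y|))))).
  rewrite ler_wpM2l ?addr_ge0// (le_trans ga)//.
  by rewrite ler_pM2l.
rewrite -Y2; move: Y0; move: (`|y|) => Y Y0.
have h1 : 0 <= s * (1 + Y ^+ 2 *+ 2 - Y).
  by rewrite mulr_ge0// mulr2n; have := sqr_ge0 (1 - Y); nra.
have h2 := sqr_ge0 (1 - Y).
by rewrite mulr2n in h1; nra.
Qed.

(* For 0 <= q + y < n this is 1 if the fractional part of q + y is less than
   2^-k, and 0 if not. *)
Definition small_frac_count (R : realType) (n : nat) (q : R) (k : nat) (y : R) :
    R :=
  \sum_(j < n) \1_(`[j%:R - q, j%:R - q + 2^-1 ^+ k[%classic) y.

(** The number of extra kernels is [L + s] with [s] least such that [2^-(L+s)] is at most the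
    fractional part. Each [k < s] then adds at least 1 to the series. *)
Lemma SOS_rank_pointwise (R : realType) (n L : nat) (q y : R) :
  (1 < n)%N -> 0 <= q ->
  (SOS_rank n (q + y) <=
    (100 * Num.sqrt n%:R)%:E *
    ((2 * (Num.sqrt q * ln n%:R) + L%:R)%:E
     + (6 * (1 + Num.sqrt q))%:E * (1 + y ^+ 2)%:E
     + \sum_(0 <= k <oo) (small_frac_count n q (L + k) y)%:E))%E.
Proof.
move=> n1 q0.
set S := (\sum_(0 <= k <oo) _)%E.
have ind0 k : (0 <= (small_frac_count n q (L + k) y)%:E)%E.
  by rewrite lee_fin sumr_ge0.
have S0 : (0 <= S)%E by apply: nneseries_ge0.
have ln0 : 0 <= ln n%:R :> R by rewrite ln_ge0// ler1n ltnW.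
have a0 : 0 <= 2 * (Num.sqrt q * ln n%:R) + L%:R.
  by rewrite addr_ge0// mulr_ge0// mulr_ge0.
have b0 : 0 <= 6 * (1 + Num.sqrt q) * (1 + y ^+ 2).
  by rewrite !mulr_ge0 ?addr_ge0 ?sqr_ge0.
have c0 : 0 <= 100 * Num.sqrt n%:R :> R by rewrite mulr_ge0.
rewrite -EFinM -EFinD.
have rhs0 : (0 <= (100 * Num.sqrt n%:R)%:E *
    ((2 * (Num.sqrt q * ln n%:R) + L%:R +
      6 * (1 + Num.sqrt q) * (1 + y ^+ 2))%:E + S))%E.
  by rewrite mule_ge0 ?lee_fin// adde_ge0// lee_fin addr_ge0.
have [qn|/SOS_rank_outside -> //] := boolP (0 <= q + y <= n%:R).
have [/SOS_rank_integer -> //|qc] := eqVneq (q + y) (Num.ceil (q + y))%:~R.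
move: qn => /andP[qy0 qyn].
have cqy : q + y < (Num.ceil (q + y))%:~R by rewrite lt_neqAle qc ceil_ge.
have [m mE] : exists m : nat, Num.ceil (q + y) = m%:Z.
  have : 0 <= Num.ceil (q + y) by rewrite -(ler_int R) (le_trans qy0)// ltW.
  by case: (Num.ceil (q + y)) => // m _; exists m.
rewrite mE -pmulrn in cqy.
have m0 : (0 < m)%N by rewrite -(ltr_nat R) (le_lt_trans qy0).
have mqy : m%:R - 1 < q + y.
  by have := ceilB1_lt (q + y); rewrite mE rmorphB/= -pmulrn.
have mn : (m <= n)%N.
  have : Num.ceil (q + y) <= n%:Z by rewrite ceil_le_int -pmulrn.
  by rewrite mE lez_nat.
set del := q + y - (m%:R - 1).
have del0 : 0 < del by rewrite subr_gt0.
have ex : exists s, 1 <= 2 ^+ (L + s) * del.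
  (* This witness exceeds [1/del], and [2^s > s]. *)
  exists (Num.truncn del^-1).+1.
  have d0 : 0 <= del^-1 by rewrite invr_ge0 ltW.
  have /andP[_ h] := truncn_itv d0.
  rewrite -ler_pdivrMr// div1r (le_trans (ltW h))//.
  rewrite -natrX ler_nat (leq_trans (ltnW (ltn_expl _ (isT : (1 < 2)%N))))//.
  by rewrite leq_exp2l// leq_addl.
have [s sP smin] := ex_minnP ex.
have mm : (0 < m <= n)%N by rewrite m0.
have qm : m%:R - 1 < q + y < m%:R by rewrite mqy.
apply: le_trans (SOS_rank_le mm qm sP) _.
rewrite EFinM lee_wpmul2l ?lee_fin//.
rewrite natrD [X in X%:E]addrA [in leLHS]EFinD leeD//.
  rewrite lee_fin addrAC lerD2r; apply: sqrt_mul_ln_le => //.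
  by have := ler_norm y; lra.
apply: (@le_trans _ _ (\sum_(0 <= k < s) (small_frac_count n q (L + k) y)%:E)%E).
  rewrite sumEFin lee_fin -[X in X%:R <= _]subn0 -[leLHS]mulr1 mulr_natl.
  rewrite -sumr_const_nat big_nat [leRHS]big_nat; apply: ler_sum => k /andP[_ ks].
  (* The integer part of [q + y] is [m - 1], so the indicator at [j = m - 1] is the one equal to
     1. *)
  have jn : (m.-1 < n)%N by rewrite prednK.
  rewrite /small_frac_count (bigD1 (Ordinal jn))//=.
  rewrite indicE mem_set; last first.
    have kdel : 2 ^+ (L + k) * del < 1.
      by rewrite ltNge; apply/negP => /smin; rewrite leqNgt ks.
    have mp : m.-1%:R = m%:R - 1 :> R by rewrite -[in RHS](prednK m0) -natr1 addrK.
    rewrite /= in_itv/= mp exprVn.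
    have : del < (2 ^+ (L + k))^-1.
      by rewrite -[ltRHS]div1r ltr_pdivlMr ?exprn_gt0// mulrC.
    by rewrite /del => h; apply/andP; split; lra.
  by rewrite lerDl sumr_ge0.
exact: nneseries_lim_ge.
Qed.

(* Monotonicity of the integral without measurability: the rank is not known to
   be a measurable function of the noise. *)
Lemma ge0_le_integralT (d : measure_display) (T : measurableType d)
    (R : realType) (mu : {measure set T -> \bar R}) (f g : T -> \bar R) :
  (forall x, 0 <= f x)%E -> (forall x, f x <= g x)%E ->
  (\int[mu]_x f x <= \int[mu]_x g x)%E.
Proof.
move=> f0 fg; have g0 x : (0 <= g x)%E by exact: le_trans (fg x).
rewrite !ge0_integralTE//; apply: ereal_sup_le => _ [h /= hf <-].
by exists h => // x; apply: le_trans (fg x).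
Qed.

(** * Gaussian expectation of the pointwise bound *)

Section NormalExpectation.
Variables (R : realType) (s q : R) (n L : nat).
Hypothesis s01 : 0 < s < 1.
Hypothesis Ls : 2^-1 ^+ L <= s.

Let nu := normal_prob (0 : R) s.

Lemma measurable_small_frac_count (k : nat) :
  measurable_fun [set: R] (small_frac_count n q k).
Proof. by apply: measurable_sum => j; exact: measurable_indic. Qed.

Lemma small_frac_count_ge0 (k : nat) (y : R) : 0 <= small_frac_count n q k y.
Proof. exact: sumr_ge0. Qed.

(** The constant is 6 from the density bound times 8 from the sum over the integers, uniformly in
    [n] and [q]. *)
Lemma integral_small_frac_count_le (k : nat) :
  (\int[nu]_y (small_frac_count n q k y)%:E <= (48 / s * 2^-1 ^+ k)%:E)%E.
Proof.
have /andP[s0 _] := s01.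
under eq_integral => y _ do rewrite -sumEFin.
rewrite ge0_integral_sum//=; last first.
  by move=> j; apply/measurable_EFinP; exact: measurable_indic.
apply: (@le_trans _ _ (\sum_(j < n)
    (2^-1 ^+ k * (6 / (s * (1 + (j%:R - q) ^+ 2))))%:E)%E).
  apply: lee_sum => j _; rewrite integral_indic//= setIT.
  apply: normal_prob_itv_le => //.
  by rewrite exprn_ge0 ?invr_ge0// exprn_ile1// ?invr_ge0// invf_le1// ler1n.
rewrite sumEFin lee_fin -mulr_sumr [leRHS]mulrC ler_wpM2l ?exprn_ge0 ?invr_ge0//.
under eq_bigr => j _ do rewrite invfM mulrA.
rewrite -mulr_sumr (_ : 48 / s = 6 / s * 8); last by field; rewrite gt_eqF.
by apply: ler_wpM2l; [rewrite divr_ge0// ltW|exact: sum_inv1Dsqr_le].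
Qed.

(** The geometric series sums to [96 2^-L / s], and [2^-L <= s]: beyond the first [L] kernels the
    expected excess is bounded. *)
Lemma integral_small_frac_series_le :
  (\int[nu]_y (\sum_(0 <= k <oo) (small_frac_count n q (L + k) y)%:E) <= 96%:E)%E.
Proof.
have /andP[s0 _] := s01.
rewrite integral_nneseries//; last 2 first.
- by move=> k; apply/measurable_EFinP; exact: measurable_small_frac_count.
- by move=> k y _; rewrite lee_fin small_frac_count_ge0.
apply: (@le_trans _ _ (\sum_(0 <= k <oo) (96 / s / (2 ^ (k + L.+1))%:R)%:E)%E).
  apply: lee_nneseries => [k _ _|k _].
    by apply: integral_ge0 => y _; rewrite lee_fin small_frac_count_ge0.
  apply: le_trans (integral_small_frac_count_le _) _.
  rewrite lee_fin natrX addnS exprS addnC exprVn.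
  rewrite (_ : 96 / s / _ = 48 / s / 2 ^+ (k + L))//; field.
  by rewrite expf_neq0//= gt_eqF.
have /cvg_lim -> // := @cvg_geometric_eseries_half R (96 / s) L.
rewrite lee_fin ler_pdivrMr ?exprn_gt0// ler_pdivrMr// -mulrA ler_peMr//.
move: Ls; rewrite exprVn -[leLHS]div1r ler_pdivrMr ?exprn_gt0//.
by rewrite mulrC.
Qed.

Let S (y : R) : \bar R := (\sum_(0 <= k <oo) (small_frac_count n q (L + k) y)%:E)%E.

Let measurable_S : measurable_fun [set: R] S.
Proof.
apply: ge0_emeasurable_sum => [k y _ _|k _].
  by rewrite lee_fin small_frac_count_ge0.
by apply/measurable_EFinP; exact: measurable_small_frac_count.
Qed.

Let measurable_1Dsqr : measurable_fun [set: R] (fun y : R => (1 + y ^+ 2)%:E).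
Proof. by apply/measurable_EFinP; apply: measurable_funD. Qed.

Let measurable_affine (a b : R) :
  measurable_fun [set: R] (fun y : R => a%:E + b%:E * (1 + y ^+ 2)%:E)%E.
Proof. by apply: emeasurable_funD => //; exact: emeasurable_funM. Qed.

Lemma measurable_pointwise_bound (c a b : R) :
  measurable_fun [set: R] (fun y => c%:E * (a%:E + b%:E * (1 + y ^+ 2)%:E
     + \sum_(0 <= k <oo) (small_frac_count n q (L + k) y)%:E))%E.
Proof.
apply: emeasurable_funM => //.
by apply: emeasurable_funD; [exact: measurable_affine|exact: measurable_S].
Qed.

Lemma integral_pointwise_bound_le (c a b : R) : 0 <= c -> 0 <= a -> 0 <= b ->
  (\int[nu]_y (c%:E * (a%:E + b%:E * (1 + y ^+ 2)%:E
     + \sum_(0 <= k <oo) (small_frac_count n q (L + k) y)%:E))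
   <= (c * (a + b * 9 + 96))%:E)%E.
Proof.
move=> c0 a0 b0.
have mS := measurable_S.
have my := measurable_1Dsqr.
have maby := measurable_affine a b.
have S0 (y : R) : (0 <= \sum_(0 <= k <oo) (small_frac_count n q (L + k) y)%:E)%E.
  by apply: nneseries_ge0 => k _ _; rewrite lee_fin small_frac_count_ge0.
have y0 (y : R) : (0 <= (1 + y ^+ 2)%:E)%E by rewrite lee_fin addr_ge0// sqr_ge0.
have mby : measurable_fun [set: R] (fun y : R => b%:E * (1 + y ^+ 2)%:E)%E.
  exact: emeasurable_funM.
have by0 (y : R) : (0 <= b%:E * (1 + y ^+ 2)%:E)%E by rewrite mule_ge0// lee_fin.
have aby0 (y : R) : (0 <= a%:E + b%:E * (1 + y ^+ 2)%:E)%E by rewrite adde_ge0.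
rewrite ge0_integralZl_EFin//=; last 2 first.
- by move=> y _; rewrite adde_ge0.
- exact: emeasurable_funD.
rewrite EFinM lee_wpmul2l ?lee_fin//.
rewrite ge0_integralD//= ge0_integralD//= ge0_integralZl_EFin//=.
rewrite !EFinD; apply: leeD; last exact: integral_small_frac_series_le.
apply: leeD; first by rewrite integral_cst//= probability_setT mule1.
rewrite EFinM lee_wpmul2l ?lee_fin//.
under eq_integral => y _ do rewrite EFinD.
rewrite ge0_integralD//=; first last.
- by apply/measurable_EFinP; exact: measurable_funX.
- by move=> y _; rewrite lee_fin sqr_ge0.
rewrite integral_cst//= probability_setT mule1.
(* Total mass 1 plus the second-moment bound 8. *)
rewrite (_ : 9%:E = 1%:E + 8%:E)%E; last by rewrite -EFinD; congr EFin; ring.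
by rewrite leeD// normal_second_moment_le.
Qed.

End NormalExpectation.

(** * From the expectation bound to the asymptotic statement *)

Lemma exists_pow2_le (R : realType) (s : R) : 0 < s < 1 ->
  exists L : nat, 2^-1 ^+ L <= s /\ L%:R <= 2 * ln (1 / s) + 1.
Proof.
move=> /andP[s0 s1]; set z := ln (1 / s).
have z0 : 0 <= z by rewrite ln_ge0// ler_pdivlMr// mul1r ltW.
have z20 : 0 <= 2 * z by rewrite mulr_ge0.
have /andP[h1 h2] := truncn_itv z20.
exists (Num.truncn (2 * z)).+1; split; last by rewrite -natr1 lerD2r.
move: h2; set L := (Num.truncn (2 * z)).+1 => h2.
have : z <= L%:R * ln 2.
  have := ler_wpM2l (ler0n R L) (ln2_ge R); lra.
rewrite mulr_natl -lnXn// ler_ln ?posrE ?exprn_gt0// ?divr_gt0//.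
rewrite ler_pdivrMr// exprVn => h.
by rewrite -[leLHS]mul1r ler_pdivrMr ?exprn_gt0// mulrC.
Qed.

Lemma ln_ge1 (R : realType) (x : R) : 4 <= x -> 1 <= ln x.
Proof.
move=> x4; have := ln2_ge R.
have : ln (2 ^+ 2) <= ln x :> R.
  by rewrite ler_ln ?posrE ?exprn_gt0//; [lra|lra].
by rewrite lnXn// mulr2n; lra.
Qed.

(* The Borel structure of R as the codomain of a random variable and the one on
   which normal_prob is a measure have the same measurable sets but distinct
   displays; the identity map transports integrals from one to the other. *)
Lemma ge0_integral_distribution_normal (d : measure_display)
    (T : measurableType d) (R : realType) (P : probability T R)
    (X : {RV P >-> R}) (m s : R) (g : R -> \bar R) :
  (forall A : set R, measurable A -> distribution P X A = normal_prob m s A) ->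
  measurable_fun [set: R] g -> (forall y, 0 <= g y)%E ->
  (\int[P]_w g (X w) = \int[normal_prob m s]_y g y)%E.
Proof.
move=> XN mg g0.
have mid : measurable_fun [set: measurableTypeR R] (idfun : measurableTypeR R -> R).
  by move=> _ A mA; rewrite setTI.
rewrite -[LHS](ge0_integral_distribution X mg g0).
transitivity (\int[pushforward (normal_prob m s)
                     (idfun : measurableTypeR R -> R)]_y g y)%E.
  by apply: eq_measure_integral => A mA _; exact: XN.
by rewrite ge0_integral_pushforward.
Qed.

Theorem theorem1p3 (R : realType) (disp : measure_display)
    (Omega : measurableType disp) (P : probability Omega R)
    (sigma : nat -> R) (eta : nat -> {RV P >-> R})
    (sigma_in01 : forall n, 0 < sigma n < 1)
    (sigma_o1 : sigma n @[n --> \oo] --> (0 : R))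
    (eta_normal : forall n (A : set R), measurable A ->
       distribution P (eta n) A = normal_prob 0 (sigma n) A) :
  exists C : R, \forall n \near \oo, forall q : R,
    0 < q < (n./2)%:R -> q - (Num.floor q)%:~R != 0 ->
    (\int[P]_w SOS_rank n (q + eta n w)
       <= (C * (Num.sqrt n%:R
                * (Num.sqrt q * ln n%:R + ln (1 / sigma n))))%:E)%E.
Proof.
(* This is 100 times 153. Once both logarithms are at least 1, that is for [n >= 4] and
   [sigma n < 1/4], the additive constants 1, 54 and 96 are absorbed into [ln (1 / sigma n)], which
   already has coefficient 2; the coefficient 56 of [sqrt q ln n] is smaller. The threshold on [n]
   does not involve [q]. *)
exists 15300.
have sigma4 : \forall n \near \oo, sigma n < 4^-1.
  by apply: (cvgr_lt _ sigma_o1); rewrite invr_gt0.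
near=> n => q /andP[q0 _] _.
have n4 : (4 <= n)%N by near: n; exact: nbhs_infty_ge.
have s01 := sigma_in01 n; have /andP[s0 s1] := s01.
have s4 : sigma n < 4^-1 by near: n.
have lnn : 1 <= ln n%:R :> R by apply: ln_ge1; rewrite ler_nat.
have lns : 1 <= ln (1 / sigma n).
  by apply: ln_ge1; rewrite ler_pdivlMr// mulrC -ler_pdivlMr// mul1r ltW.
have [L [Ls Lle]] := exists_pow2_le s01.
have n1 : (1 < n)%N by apply: leq_trans n4.
pose a := 2 * (Num.sqrt q * ln n%:R) + L%:R.
pose b := 6 * (1 + Num.sqrt q).
pose c : R := 100 * Num.sqrt n%:R.
pose g (y : R) : \bar R := (c%:E * (a%:E + b%:E * (1 + y ^+ 2)%:E
     + \sum_(0 <= k <oo) (small_frac_count n q (L + k) y)%:E))%E.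
have q0' : 0 <= q := ltW q0.
have sq0 : 0 <= Num.sqrt q := sqrtr_ge0 q.
have c0 : 0 <= c by rewrite mulr_ge0.
have b0 : 0 <= b by rewrite mulr_ge0// addr_ge0.
have sl0 : 0 <= Num.sqrt q * ln n%:R by rewrite mulr_ge0//; lra.
have a0 : 0 <= a by rewrite addr_ge0// mulr_ge0.
have rank_g (y : R) : (SOS_rank n (q + y)%R <= g y)%E.
  exact: SOS_rank_pointwise.
have g0 (y : R) : (0 <= g y)%E by apply: le_trans (rank_g y); exact: SOS_rank_ge0.
apply: (@le_trans _ _ (\int[P]_w g (eta n w))%E).
  by apply: ge0_le_integralT => w; [exact: SOS_rank_ge0|exact: rank_g].
have mg : measurable_fun [set: R] g.
  exact: measurable_pointwise_bound.
rewrite (ge0_integral_distribution_normal (eta_normal n) mg g0).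
apply: le_trans (integral_pointwise_bound_le q n s01 Ls c0 a0 b0) _.
rewrite lee_fin /c /a /b.
have -> : 15300 * (Num.sqrt n%:R * (Num.sqrt q * ln n%:R + ln (1 / sigma n))) =
  100 * Num.sqrt n%:R * (153 * (Num.sqrt q * ln n%:R + ln (1 / sigma n))) :> R.
  by ring.
rewrite ler_wpM2l//.
have : Num.sqrt q <= Num.sqrt q * ln n%:R by rewrite ler_peMr.
lra.
Unshelve. all: by end_near. Qed.
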